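(* Let $0.85798\leq\omega\leq1$. For every $N$-qubit quantum state $\rho_{AB_1\cdots B_{N-1}}$, $$\mathfrak{C}_\omega^2(\rho_{A|B_1\cdots B_{N-1}})\geq\mathfrak{C}_\omega^2(\rho_{AB_1})+\cdots+\mathfrak{C}_\omega^2(\rho_{AB_{N-1}}),$$ where $\mathfrak{C}_\omega(\rho_{A|B_1\cdots B_{N-1}})$ is the $G_\omega$-concurrence in the bipartition $A|B_1\cdots B_{N-1}$, $\rho_{AB_j}$ is the reduced density matrix on $AB_j$, and $\mathfrak{C}_\omega^2(\cdot)=[\mathfrak{C}_\omega(\cdot)]^2$.
   Context: For $0<\omega\leq1$ the $G_\omega$-concurrence of a bipartite pure state $|\varphi\rangle_{XY}$ is $\mathfrak{C}_\omega(|\varphi\rangle_{XY})=[\mathrm{tr}(\rho_X^\omega)-1]^\omega$ with $\rho_X=\mathrm{tr}_Y(|\varphi\rangle_{XY}\langle\varphi|)$ (with $0^\omega=0$ on the kernel of $\rho_X$). For a mixed bipartite state, $\mathfrak{C}_\omega(\rho_{XY})=\min\sum_i p_i\,\mathfrak{C}_\omega(|\varphi_i\rangle_{XY})$, the minimum being over all pure state decompositions $\rho_{XY}=\sum_i p_i|\varphi_i\rangle\langle\varphi_i|$. For an $N$-qubit state ($N\ge2$), the bipartition $A|B_1\cdots B_{N-1}$ means $X=A$ and $Y=B_1\cdots B_{N-1}$. *)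

(* Defs.v *)
From HB Require Import structures.
From mathcomp Require Import all_boot all_order all_algebra.
From mathcomp Require Import all_classical all_reals all_analysis.
From mathcomp.real_closed Require Import complex.

Set Implicit Arguments.
Unset Strict Implicit.
Unset Printing Implicit Defensive.

Import Order.TTheory GRing.Theory Num.Theory.

Local Open Scope ring_scope.
Local Open Scope complex_scope.
Local Open Scope sesquilinear_scope.
Local Open Scope classical_set_scope.

(* Positive semidefinite with unit trace. On [R[i]], [0 <= z] means that [z] is
   real and nonnegative. *)
Definition is_density (R : realType) (n : nat) (rho : 'M[R[i]]_n) : Prop :=
  [/\ rho \is hermsymmx,
      forall v : 'cV[R[i]]_n, 0 <= (v ^t* *m rho *m v) 0 0 &
      \tr rho = 1].

Definition is_unit_vector (R : realType) (n : nat) (phi : 'cV[R[i]]_n) : Prop :=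
  (phi ^t* *m phi) 0 0 = 1.

Definition ketbra (R : realType) (n : nat) (phi : 'cV[R[i]]_n) : 'M[R[i]]_n :=
  phi *m phi ^t*.

(* The power A^w of a positive semidefinite matrix, by functional calculus on
   the spectral decomposition A = P^-1 diag(d) P. Since [0 `^ w = 0] for
   [w != 0], it vanishes on the kernel of A. *)
Definition mxpowR (R : realType) (n : nat) (A : 'M[R[i]]_n) (w : R) :
    'M[R[i]]_n :=
  invmx (spectralmx A)
    *m diag_mx (\row_i ((complex.Re (spectral_diag A 0 i)) `^ w)%:C)
    *m spectralmx A.

(* Operators on C^X (X) C^Y, for finite types X and Y indexing orthonormal
   bases, are the matrices of size [#|{: X * Y}|]; the basis vector |x,y> has
   index [enum_rank (x, y)]. [ptrace2] is the trace over the second factor. *)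
Definition ptrace2 (R : realType) (X Y : finType)
    (rho : 'M[R[i]]_#|{: X * Y}|) : 'M[R[i]]_#|X| :=
  \matrix_(i, j) \sum_(y : Y)
    rho (enum_rank (enum_val i, y)) (enum_rank (enum_val j, y)).

Definition Gconc_pure (R : realType) (w : R) (X Y : finType)
    (phi : 'cV[R[i]]_#|{: X * Y}|) : R :=
  (complex.Re (\tr (mxpowR (ptrace2 (ketbra phi)) w)) - 1) `^ w.

(* The average values sum_i p_i C_w(phi_i) over all the finite pure state
   decompositions of [rho]. *)
Definition Gconc_averages (R : realType) (w : R) (X Y : finType)
    (rho : 'M[R[i]]_#|{: X * Y}|) : set R :=
  [set a | exists (k : nat) (p : 'I_k -> R)
             (phi : 'I_k -> 'cV[R[i]]_#|{: X * Y}|),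
    [/\ (forall i, 0 <= p i) /\ \sum_i p i = 1,
        forall i, is_unit_vector (phi i),
        rho = \sum_i (p i)%:C *: ketbra (phi i) &
        a = \sum_i p i * Gconc_pure w (phi i)]].

(* The minimum over the decompositions, as the total operator [inf]: it is the
   minimum of the set whenever this is attained, which is the case for density
   matrices (w > 0) by compactness and Caratheodory's theorem. *)
Definition Gconc (R : realType) (w : R) (X Y : finType)
    (rho : 'M[R[i]]_#|{: X * Y}|) : R :=
  inf (Gconc_averages w rho).

Definition qubit : finType := 'I_2.

(* The computational basis of n qubits; [y j] is the bit of the j-th one. *)
Definition qubits (n : nat) : finType := {ffun 'I_n -> qubit}.

Definition set_bit (n : nat) (j : 'I_n) (y : qubits n) (b : qubit) : qubits n :=
  [ffun k => if k == j then b else y k].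

(* The reduced matrix rho_{A B_j} of an operator on A B_0 ... B_{n-1}: the
   entry at |a,b><a',b'| is the sum over the bits of all the B_k with k != j.
   Each assignment of these bits is represented by the unique [y] that extends
   it by [y j = b]. *)
Definition reduced_AB (R : realType) (n : nat) (j : 'I_n)
    (rho : 'M[R[i]]_#|{: qubit * qubits n}|) : 'M[R[i]]_#|{: qubit * qubit}| :=
  \matrix_(r, c)
    let: (a, b) := enum_val r in
    let: (a', b') := enum_val c in
    \sum_(y : qubits n | y j == b)
      rho (enum_rank (a, y)) (enum_rank (a', set_bit j y b')).

(* Main.v *)
(* For a pure state on A|B_1...B_n the G-concurrence is Gsq (C^2), where
   C^2 = 4 det rho_A is the squared concurrence and Gsq = h^w with
   h = v^w + (1 - v)^w - 1 and v (1 - v) = C^2 / 4. The map x |-> Gsq(x)^2 / x is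
   nondecreasing, so Gsq^2 is superadditive in C^2, and it is enough to bound
   concurrences of pure states: a mixed state is handled by Minkowski's
   inequality, since the G-concurrence is at most its average over any mixture.

   Wootters' equal-concurrence decompositions give G(rho_AB) <= Gsq (c^2) as soon
   as some decomposition of rho_AB has average concurrence c; convexity of Gsq is
   never needed. The monogamy sum_j C(rho_ABj)^2 <= 4 det rho_A of pure states is
   proved by measuring the qubits B_j one after the other. If rho_AB = sum_i
   |Phi_i><Phi_i| comes from a Takagi frame (four 2x2 matrices Phi_i that are
   orthogonal for the polarized determinant), there is an orthonormal basis of B
   such that the unnormalized post-measurement states R_0, R_1 of A satisfy
   (sqrt det R_0 + sqrt det R_1)^2 + k^2 <= det (R_0 + R_1), where 2 k bounds the
   concurrence of rho_AB. It is the eigenbasis of an indefinite hermitian E for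
   which all the Phi_i E Phi_i^* have a common isotropic vector. *)

Require Import Defs.
From HB Require Import structures.
From mathcomp Require Import all_boot all_order all_algebra.
From mathcomp Require Import all_classical all_reals all_analysis.
From mathcomp.real_closed Require Import complex.
From mathcomp Require Import ring lra.

Set Implicit Arguments.
Unset Strict Implicit.
Unset Printing Implicit Defensive.

Import Order.TTheory GRing.Theory Num.Theory.

Local Open Scope ring_scope.

(** * Superadditivity of Gsq^2 *)

Lemma is_derive_ge0_le (R : realType) (f df : R -> R) (a b : R) :
  a <= b -> (forall x, a <= x <= b -> is_derive x 1 f (df x)) ->
  (forall x, a <= x <= b -> 0 <= df x) -> f a <= f b.
Proof.
move=> ab dfE df0.
apply: (@ger0_derive1_le_cc _ f a b _ _ _ a b); rewrite ?in_itv /= ?lexx ?ab //.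
- move=> x; rewrite in_itv /= => /andP[/ltW ax /ltW xb].
  have dx : is_derive x 1 f (df x) by apply: dfE; rewrite ax.
  exact: ex_derive.
- move=> x; rewrite in_itv /= => /andP[/ltW ax /ltW xb].
  have dx : is_derive x 1 f (df x) by apply: dfE; rewrite ax.
  by rewrite derive1E derive_val df0 // ax.
- apply: derivable_within_continuous => x; rewrite in_itv /= => xab.
  have dx : is_derive x 1 f (df x) by apply: dfE.
  exact: ex_derive.
Qed.

Section derive_rules.
Variables (R : realType) (x : R).
Implicit Types f g : R -> R.

Lemma is_derive_add f g a b : is_derive x 1 f a -> is_derive x 1 g b ->
  is_derive x 1 (fun y => f y + g y) (a + b).
Proof. exact: is_deriveD. Qed.

Lemma is_derive_opp f a : is_derive x 1 f a ->
  is_derive x 1 (fun y => - f y) (- a).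
Proof. exact: is_deriveN. Qed.

Lemma is_derive_mul f g a b : is_derive x 1 f a -> is_derive x 1 g b ->
  is_derive x 1 (fun y => f y * g y) (f x * b + g x * a).
Proof. exact: is_deriveM. Qed.

Lemma is_derive_scale f a (k : R) : is_derive x 1 f a ->
  is_derive x 1 (fun y => k * f y) (k * a).
Proof. exact: is_deriveZ. Qed.

Lemma is_derive_comp f g a b : is_derive (g x) 1 f a -> is_derive x 1 g b ->
  is_derive x 1 (fun y => f (g y)) (a * b).
Proof. exact: is_derive1_comp. Qed.

Lemma is_derive_inv f a : f x != 0 -> is_derive x 1 f a ->
  is_derive x 1 (fun y => (f y)^-1) (- (f x) ^- 2 * a).
Proof.
move=> fx0 fa; apply: DeriveDef.
  by apply: derivableV => //; apply: ex_derive.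
have df := @ex_derive _ _ _ _ _ _ _ fa.
rewrite deriveV //.
by rewrite derive_val.
Qed.

Lemma is_derive_subl (c : R) : is_derive x 1 (fun y => c - y) (- 1).
Proof.
apply: (is_derive_eq (is_derive_add (is_derive_cst c x 1)
  (is_derive_opp (is_derive_id x 1)))).
by rewrite add0r.
Qed.

End derive_rules.

(** Both sides vanish together at 1 up to sign, and the derivative of [z - z^-1 - 2 * ln z] is
    [(1 - z^-1) ^+ 2]. *)
Lemma ln_le_subV (R : realType) (z : R) : 1 <= z -> ln z *+ 2 <= z - z^-1.
Proof.
move=> z1.
pose f (x : R) := x + - x^-1 + - (2 * ln x).
pose df (x : R) := (1 - x^-1) ^+ 2.
suff : f 1 <= f z by rewrite /f invr1 ln1 -mulr_natl; lra.
apply: (is_derive_ge0_le (f := f) (df := df) z1) => x /andP[x1 _]; last first.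
  exact: sqr_ge0.
have x0 : 0 < x by lra.
have dV : is_derive x 1 (fun y : R => y^-1) (- x ^- 2 * 1).
  exact: (is_derive_inv (f := id) (lt0r_neq0 x0) (is_derive_id x 1)).
apply: (is_derive_eq (is_derive_add (is_derive_add (is_derive_id x 1)
  (is_derive_opp dV)) (is_derive_opp (is_derive_scale 2 (is_derive1_ln x0))))).
by rewrite /df; field; rewrite gt_eqF.
Qed.

(** This is [ln_le_subV] at the inverse square root of [t]. *)
Lemma oppr_ln_le (R : realType) (t : R) :
  0 < t <= 1 -> - ln t <= (1 - t) / Num.sqrt t.
Proof.
move=> /andP[t0 t1].
set r := Num.sqrt t; have r0 : 0 < r by rewrite sqrtr_gt0.
have rE : r ^+ 2 = t by rewrite sqr_sqrtr ?ltW.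
have r1 : r <= 1 by rewrite -sqrtr1 ler_wsqrtr.
have := @ln_le_subV _ r^-1; rewrite invf_ge1 // => /(_ r1).
rewrite lnV ?posrE // invrK -rE lnXn // => h.
rewrite -mulNrn; apply: (le_trans h).
by rewrite mulrBl mul1r expr2 mulfK // gt_eqF.
Qed.

(* At [v = 1/2] this is an equality; the derivative of the difference of the
   two sides is controlled by [oppr_ln_le] and [sqrt v + sqrt u <= sqrt 2]. *)
Lemma entropy_skew (R : realType) (d v : R) : 0 <= d -> 2 <= (2 - d) ^+ 2 ->
  d <= 1 -> 0 < v <= 2^-1 ->
  - ln (1 - v) * (1 - v) * (1 - d * v) <= - ln v * v * (1 - d * (1 - v)).
Proof.
move=> d0 d2 d1 /andP[v0 v2].
(* The right side minus the left side is [v * (1 - v) * - f v], so it is enough that [f] increases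
   up to its zero at 1/2. *)
pose f (x : R) := ln x * (1 - x)^-1 + - (ln (1 - x) * x^-1)
  + - (d * (ln x + - ln (1 - x))).
pose df (x : R) := (x * (1 - x))^-1 *
  (2 - d + ln x * (x / (1 - x)) + ln (1 - x) * ((1 - x) / x)).
have h : f v <= f 2^-1.
  apply: (is_derive_ge0_le (f := f) (df := df) v2) => x /andP[vx x2].
    have x0 : 0 < x by lra.
    have u0 : 0 < 1 - x by lra.
    have dln := is_derive1_ln x0.
    have dlnu : is_derive x 1 (fun y : R => ln (1 - y)) ((1 - x)^-1 * - 1).
      exact: (is_derive_comp (g := fun y => 1 - y) (is_derive1_ln u0)
        (is_derive_subl x 1)).
    have dV : is_derive x 1 (fun y : R => y^-1) (- x ^- 2 * 1).
      exact: (is_derive_inv (f := id) (lt0r_neq0 x0) (is_derive_id x 1)).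
    have dVu : is_derive x 1 (fun y : R => (1 - y)^-1) (- (1 - x) ^- 2 * - 1).
      exact: (is_derive_inv (f := fun y => 1 - y) (lt0r_neq0 u0)
        (is_derive_subl x 1)).
    apply: (is_derive_eq (is_derive_add (is_derive_add (is_derive_mul dln dVu)
      (is_derive_opp (is_derive_mul dlnu dV)))
      (is_derive_opp (is_derive_scale d (is_derive_add dln
        (is_derive_opp dlnu)))))).
    by rewrite /df; field; rewrite !gt_eqF.
  have x0 : 0 < x by lra.
  have u0 : 0 < 1 - x by lra.
  apply: mulr_ge0; first by rewrite invr_ge0 mulr_ge0 ?ltW.
  have := @oppr_ln_le _ x; rewrite x0 => /(_ ltac:(lra)) hx.
  have := @oppr_ln_le _ (1 - x); rewrite u0 => /(_ ltac:(lra)) hu.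
  set a := Num.sqrt x in hx; set b := Num.sqrt (1 - x) in hu.
  have a0 : 0 < a by rewrite sqrtr_gt0.
  have b0 : 0 < b by rewrite sqrtr_gt0.
  have aE : a ^+ 2 = x by rewrite sqr_sqrtr ?ltW.
  have bE : b ^+ 2 = 1 - x by rewrite sqr_sqrtr ?ltW.
  have h1 : - ln x * (x / (1 - x)) <= a.
    have -> : a = (1 - x) / a * (x / (1 - x)).
      by rewrite -{2}aE; field; rewrite !gt_eqF.
    by rewrite ler_wpM2r // divr_ge0 ?ltW.
  have h2 : - ln (1 - x) * ((1 - x) / x) <= b.
    have -> : b = (1 - (1 - x)) / b * ((1 - x) / x).
      by rewrite -{2}bE; field; rewrite !gt_eqF.
    by rewrite ler_wpM2r // divr_ge0 ?ltW.
  have : a + b <= 2 - d by rewrite -(@ler_pXn2r _ 2) ?nnegrE //; nra.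
  by move: h1 h2; rewrite !mulNr; lra.
have f0 : f 2^-1 = 0.
  have -> : f 2^-1 = ln 2^-1 * (2^-1)^-1 - (ln 2^-1 * 2^-1^-1)
     - d * (ln 2^-1 - ln 2^-1).
    by rewrite /f; have -> : 1 - 2^-1 = 2^-1 :> R by lra.
  by rewrite !subrr mulr0 subr0.
have v'0 : 0 < 1 - v by lra.
rewrite -subr_ge0.
have -> : - ln v * v * (1 - d * (1 - v)) - - ln (1 - v) * (1 - v) * (1 - d * v)
  = v * (1 - v) * - f v by rewrite /f; field; rewrite !gt_eqF.
by apply: mulr_ge0; [rewrite mulr_ge0 ?ltW | rewrite oppr_ge0 -f0].
Qed.

(** Monotonicity of [(expR x - 1) / x], free of division so that [x = 0] is covered. With
    [s = y - x] it follows from [1 + s <= expR s] and [1 - x <= expR (- x)]. *)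
Lemma expR_slope (R : realType) (x y : R) :
  0 <= x <= y -> (expR x - 1) * y <= (expR y - 1) * x.
Proof.
move=> /andP[x0 xy]; have -> : y = x + (y - x) by lra.
set s := y - x; have s0 : 0 <= s by rewrite /s; lra.
rewrite expRD.
have hs := expR_ge1Dx s; have hx := expR_ge1Dx (- x).
have e0 := expR_gt0 x.
have he : expR x * expR (- x) = 1 by exact: expRxMexpNx_1.
have h1 : 0 <= expR x * x * (expR s - (1 + s)).
  by rewrite !mulr_ge0 ?(ltW e0) // subr_ge0.
have h2 : 0 <= s * expR x * (expR (- x) - (1 + - x)).
  by rewrite !mulr_ge0 ?(ltW e0) // subr_ge0.
rewrite -subr_ge0.
have -> : (expR x * expR s - 1) * x - (expR x - 1) * (x + s) =
  expR x * x * (expR s - (1 + s)) + s * expR x * (expR (- x) - (1 + - x))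
  - s * (expR x * expR (- x) - 1) by ring.
by rewrite he; lra.
Qed.

(** The last hypothesis says that the logarithmic derivative of P(x)^c / (x (1 - x)) is
    nonnegative. *)
Lemma powR_ratio_le (R : realType) (P dP : R -> R) (c a b : R) :
  0 < a -> a <= b -> b < 1 ->
  (forall x, a <= x <= b -> 0 < P x) ->
  (forall x, a <= x <= b -> is_derive x 1 P (dP x)) ->
  (forall x, a <= x <= b -> (1 - x - x) * P x <= c * (x * (1 - x)) * dP x) ->
  P a `^ c * (b * (1 - b)) <= P b `^ c * (a * (1 - a)).
Proof.
move=> a0 ab b1 P0 dPE hP.
pose f (x : R) := c * ln (P x) + - ln x + - ln (1 - x).
pose df (x : R) := (x * (1 - x) * P x)^-1 *
  (c * (x * (1 - x)) * dP x - (1 - x - x) * P x).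
have hf : f a <= f b.
  apply: (is_derive_ge0_le (f := f) (df := df) ab) => x /[dup] xab /andP[ax xb].
    have x0 : 0 < x by lra.
    have u0 : 0 < 1 - x by lra.
    have dlnu : is_derive x 1 (fun y : R => ln (1 - y)) ((1 - x)^-1 * - 1).
      exact: (is_derive_comp (g := fun y => 1 - y) (is_derive1_ln u0)
        (is_derive_subl x 1)).
    have dlnP : is_derive x 1 (fun y : R => ln (P y)) ((P x)^-1 * dP x).
      exact: (is_derive_comp (is_derive1_ln (P0 _ xab)) (dPE _ xab)).
    have dlnx := is_derive1_ln x0.
    apply: (is_derive_eq (is_derive_add (is_derive_add
      (is_derive_scale c dlnP) (is_derive_opp dlnx)) (is_derive_opp dlnu))).
    by rewrite /df; field; rewrite !gt_eqF // P0.
  have x0 : 0 < x by lra.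
  have u0 : 0 < 1 - x by lra.
  apply: mulr_ge0; last by rewrite subr_ge0 hP.
  by rewrite invr_ge0 mulr_ge0 // ltW ?mulr_gt0 // P0.
have Pa : 0 < P a by rewrite P0 // lexx.
have Pb : 0 < P b by rewrite P0 // lexx andbT.
have ua : 0 < 1 - a by lra.
have ub : 0 < 1 - b by lra.
have b0 : 0 < b by lra.
rewrite -ler_ln ?posrE; last 2 first.
- by rewrite !mulr_gt0 // powR_gt0.
- by rewrite !mulr_gt0 // powR_gt0.
rewrite !lnM ?posrE //; last 4 first.
- exact: powR_gt0.
- exact: mulr_gt0.
- exact: powR_gt0.
- exact: mulr_gt0.
by move: hf; rewrite /f !ln_powR; lra.
Qed.

Ltac itv_lra := apply/andP; split; lra.

Section Gfun.
Variables (R : realType) (w : R).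

(** The value of tr(rho^w) - 1 for a qubit state rho with eigenvalues v and 1 - v. *)
Definition powdef (v : R) : R := v `^ w + (1 - v) `^ w - 1.

Hypothesis w01 : 0 < w <= 1.
(* [2 w^2 >= sqrt 2] is all that is used of the threshold on [w]. *)
Hypothesis w4 : 2 <= (2 * w ^+ 2) ^+ 2.

(** Let [d = 2 - 2 * w ^+ 2], and let p and q be the excesses over 1 of the powers of exponent w - 1
    of 1 - v and v. The claim becomes (1 - v) p (1 - d v) <= v q (1 - d (1 - v)). [entropy_skew] is
    this with - ln (1 - v) and - ln v in place of p and q, and [expR_slope] gives p / - ln (1 - v)
    <= q / - ln v. *)
Lemma powdef_logderive v : 0 < v <= 2^-1 ->
  (1 - v - v) * powdef v <=
  2 * w ^+ 2 * (v * (1 - v)) * (v `^ (w - 1) - (1 - v) `^ (w - 1)).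
Proof.
have /andP[w0 w1] := w01.
move=> /[dup] hv /andP[v0 v2]; have u0 : 0 < 1 - v by lra.
have d0 : 0 <= 2 - 2 * w ^+ 2 by nra.
have d1 : 2 - 2 * w ^+ 2 <= 1.
  have := sqr_ge0 w; have := w4; set t := w ^+ 2 => t4 t0; nra.
have := @entropy_skew _ (2 - 2 * w ^+ 2) v d0 _ d1 hv.
have -> : 2 - (2 - 2 * w ^+ 2) = 2 * w ^+ 2 by ring.
move=> /(_ w4).
set d := 2 - 2 * w ^+ 2 in d0 d1 *.
have wd : 2 * w ^+ 2 = 2 - d by rewrite /d; ring.
rewrite wd /powdef -(mulr_powRB1 (ltW v0) w0) -(mulr_powRB1 (ltW u0) w0).
rewrite /powR !gt_eqF //.
set l := ln v; set m := ln (1 - v).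
have lm : l <= m by rewrite ler_ln ?posrE //; lra.
have m0 : m < 0 by apply: ln_lt0; itv_lra.
have pq : (expR ((w - 1) * m) - 1) * - l <= (expR ((w - 1) * l) - 1) * - m.
  have := @expR_slope _ ((w - 1) * m) ((w - 1) * l).
  move=> /(_ ltac:(apply/andP; split; nra)) h.
  (* The slope inequality carries a factor [1 - w], which can be cancelled only if it is nonzero; at
     [w = 1] both sides are 0. *)
  have [->|w1'] := eqVneq w 1; first by rewrite subrr !mul0r expR0 subrr !mul0r.
  have w1'' : 0 < 1 - w by rewrite subr_gt0 lt_neqAle w1' w1.
  by rewrite -(@ler_pM2l _ (1 - w)) //; lra.
have p0 : 0 <= expR ((w - 1) * m) - 1.
  by have := expR_ge1Dx ((w - 1) * m); nra.
move: p0 pq; set p := expR ((w - 1) * m) - 1; set q := expR ((w - 1) * l) - 1.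
move=> p0 pq es.
have -> : expR ((w - 1) * m) = p + 1 by rewrite /p; ring.
have -> : expR ((w - 1) * l) = q + 1 by rewrite /q; ring.
have du : 0 <= 1 - d * (1 - v) by nra.
have h : (1 - v) * p * (1 - d * v) <= v * q * (1 - d * (1 - v)).
  rewrite -(@ler_pM2r _ (- m)) ?oppr_gt0 //.
  have h1 := ler_wpM2l p0 es.
  have h2 := ler_wpM2r (mulr_ge0 (ltW v0) du) pq.
  lra.
lra.
Qed.

(** For w < 1 and 0 < t < 1 the power t^w exceeds t, and v + (1 - v) = 1. *)
Lemma powdef_gt0 v : w < 1 -> 0 < v < 1 -> 0 < powdef v.
Proof.
have /andP[w0 w1] := w01.
have hp t : w < 1 -> 0 < t < 1 -> t < t `^ w.
  move=> w1' /andP[t0 t1]; rewrite -[ltLHS](mulr1) -(mulr_powRB1 (ltW t0) w0).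
  rewrite ltr_pM2l // /powR gt_eqF // expR_gt1.
  have := @ln_lt0 _ t; rewrite t0 t1 => /(_ isT); nra.
move=> w1' /andP[v0 v1]; have /(hp _ w1') h1 : 0 < v < 1 by itv_lra.
have /(hp _ w1') h2 : 0 < 1 - v < 1 by itv_lra.
by rewrite /powdef; lra.
Qed.

Lemma powdef_ratio v1 v2 : 0 < v1 -> v1 <= v2 -> v2 <= 2^-1 ->
  powdef v1 `^ (2 * w) * (v2 * (1 - v2)) <=
  powdef v2 `^ (2 * w) * (v1 * (1 - v1)).
Proof.
have /andP[w0 w1] := w01.
move=> v10 v12 v22.
(* At [w = 1] the function [powdef] is identically 0 on the unit interval and has no logarithm. *)
have [w1'|w1'] := eqVneq w 1.
  have H0 v : 0 <= v -> 0 <= 1 - v -> powdef v = 0.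
    by move=> v0 u0; rewrite /powdef w1' !powRr1 //; ring.
  rewrite !H0 ?powR0 ?mul0r //; lra || by rewrite w1' mulr1.
have {}w1' : w < 1 by rewrite lt_neqAle w1' w1.
apply: (powR_ratio_le (dP := fun x : R =>
  w * (x `^ (w - 1) - (1 - x) `^ (w - 1)))) => //; first by lra.
- by move=> x /andP[h1 h2]; apply: powdef_gt0 => //; itv_lra.
- move=> x /andP[vx x2]; have x0 : 0 < x by lra.
  have u0 : 0 < 1 - x by lra.
  have d1 := is_derive1_powR w x0.
  have d2 : is_derive x 1 (fun y : R => (1 - y) `^ w)
      (w * (1 - x) `^ (w - 1) * -1).
    exact: (is_derive_comp (f := fun y => y `^ w) (g := fun y => 1 - y)
      (is_derive1_powR w u0) (is_derive_subl x 1)).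
  have d12 : is_derive x 1 (fun v : R => v `^ w + (1 - v) `^ w)
      (w * x `^ (w - 1) + w * (1 - x) `^ (w - 1) * -1).
    exact: (is_derive_add d1 d2).
  have -> : w * (x `^ (w - 1) - (1 - x) `^ (w - 1)) =
    w * x `^ (w - 1) + w * (1 - x) `^ (w - 1) * -1 + 0 by ring.
  rewrite /powdef.
  exact: (is_derive_add (g := fun=> -1) d12 (is_derive_cst (- 1 : R) x 1)).
- move=> x /andP[vx x2]; have /powdef_logderive : 0 < x <= 2^-1 by itv_lra.
  by move=> h; apply: (le_trans h); rewrite le_eqVlt; apply/orP; left; apply/eqP; ring.
Qed.

End Gfun.

(* The smaller eigenvalue of a qubit state of determinant [x / 4]. *)
Definition small_ev (R : realType) (x : R) : R := (1 - Num.sqrt (1 - x)) / 2.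

(* Locked, since comparing two values of it by conversion does not terminate
   in practice. *)
HB.lock Definition Gsq (R : realType) (w x : R) : R :=
  powdef w (small_ev x) `^ w.

Section Gsq_theory.
Variables (R : realType) (w : R).
Hypothesis w01 : 0 < w <= 1.
Hypothesis w4 : 2 <= (2 * w ^+ 2) ^+ 2.
Implicit Types x y : R.
Local Notation powdef := (powdef w).
Local Notation Gsq := (Gsq w).

Lemma small_ev_itv x : 0 <= x <= 1 -> 0 <= small_ev x <= 2^-1.
Proof.
move=> /andP[x0 x1]; rewrite /small_ev.
have := sqrtr_ge0 (1 - x).
have : Num.sqrt (1 - x) <= 1 by rewrite -[leRHS]sqrtr1 ler_wsqrtr //; lra.
by move=> h1 h2; itv_lra.
Qed.

Lemma small_evE x : x <= 1 -> 4 * (small_ev x * (1 - small_ev x)) = x.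
Proof.
move=> x1; have := @sqr_sqrtr _ (1 - x); rewrite subr_ge0 => /(_ x1).
rewrite /small_ev; set r := Num.sqrt _ => rE.
have -> : x = 1 - r ^+ 2 by rewrite rE; ring.
by field.
Qed.

Lemma le_small_ev x y : x <= y -> small_ev x <= small_ev y.
Proof.
move=> xy; rewrite /small_ev ler_wpM2r ?invr_ge0 // lerD2l lerN2.
by rewrite ler_wsqrtr // lerD2l lerN2.
Qed.

Lemma Gsq_ge0 x : 0 <= Gsq x. Proof. by rewrite Gsq.unlock powR_ge0. Qed.

Lemma Gsq0 : Gsq 0 = 0.
Proof.
have /andP[w0 _] := w01.
rewrite Gsq.unlock /small_ev subr0 sqrtr1 subrr mul0r /powdef subr0.
by rewrite powR0 ?gt_eqF // powR1 add0r subrr powR0 // gt_eqF.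
Qed.

(** The square of [Gsq] is the power of exponent 2 w of [powdef] at the smaller eigenvalue v, and
    the argument is 4 v (1 - v), so this is [powdef_ratio]. That lemma asks for v > 0, whence the
    separate case [x = 0]. *)
Lemma Gsq_ratio x y : 0 <= x -> x <= y -> y <= 1 ->
  Gsq x ^+ 2 * y <= Gsq y ^+ 2 * x.
Proof.
have /andP[w0 w1] := w01.
rewrite le_eqVlt => /predU1P[<- _ _|x0 xy y1].
  by rewrite Gsq0 expr0n mul0r mulr0.
have x1 : x <= 1 by lra.
have Gsq2 z : Gsq z ^+ 2 = powdef (small_ev z) `^ (2 * w).
  by rewrite Gsq.unlock mulrC powRrM powR_mulrn // powR_ge0.
have /small_ev_itv/andP[ex0 _] : 0 <= x <= 1 by itv_lra.
have /small_ev_itv/andP[_ ey] : 0 <= y <= 1 by itv_lra.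
have ex : 0 < small_ev x.
  rewrite lt_neqAle ex0 andbT; apply/eqP => e.
  by move: x0; rewrite -(small_evE x1) -e mul0r mulr0 ltxx.
have key (a b s t A B : R) : A ^+ 2 = a -> B ^+ 2 = b -> 4 * s = x ->
    4 * t = y -> a * t <= b * s -> A ^+ 2 * y <= B ^+ 2 * x.
  by move=> -> -> <- <- h; rewrite mulrCA [leRHS]mulrCA ler_pM2l.
exact: (key _ _ _ _ _ _ (Gsq2 x) (Gsq2 y) (small_evE x1) (small_evE y1)
  (powdef_ratio w01 w4 ex (le_small_ev xy) ey)).
Qed.

Lemma le_Gsq x y : 0 <= x -> x <= y -> y <= 1 -> Gsq x <= Gsq y.
Proof.
move=> x0 xy y1; rewrite -(@ler_pXn2r _ 2) ?nnegrE ?Gsq_ge0 //.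
have [y0|y0] := ltP 0 y; last first.
  by have -> : x = y by lra.
rewrite -(ler_pM2r y0); apply: (le_trans (Gsq_ratio x0 xy y1)).
by rewrite ler_wpM2l // exprn_ge0 // Gsq_ge0.
Qed.

(** By [Gsq_ratio] each term is at most the fraction [x i / y] of [Gsq y ^+ 2], and these fractions
    sum to at most 1. *)
Lemma Gsq_superadditive n (x : 'I_n -> R) y : (forall i, 0 <= x i) ->
  \sum_i x i <= y -> y <= 1 -> \sum_i Gsq (x i) ^+ 2 <= Gsq y ^+ 2.
Proof.
move=> x0 xy y1.
have xi i : x i <= y.
  by apply: le_trans xy; rewrite (bigD1 i) //= lerDl sumr_ge0.
have y0 : 0 <= y by apply: le_trans xy; apply: sumr_ge0.
have [{}y0|y0'] := ltP 0 y; last first.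
  rewrite big1 ?exprn_ge0 ?Gsq_ge0 // => i _.
  have -> : x i = 0 by have := xi i; have := x0 i; lra.
  by rewrite Gsq0 expr0n.
rewrite -(ler_pM2r y0) mulr_suml.
apply: (@le_trans _ _ (\sum_i Gsq y ^+ 2 * x i)).
  by apply: ler_sum => i _; apply: Gsq_ratio.
by rewrite -mulr_sumr ler_wpM2l // exprn_ge0 // Gsq_ge0.
Qed.

End Gsq_theory.

(** The second bound amounts to w^4 >= 1/2, and already 4 (17/20)^4 > 2. *)
Lemma threshold_bound (R : realType) (w : R) :
  (85 * 10 ^+ 3 + 798) / 10 ^+ 5 <= w <= 1 ->
  0 < w <= 1 /\ 2 <= (2 * w ^+ 2) ^+ 2.
Proof.
move=> /andP[h w1]; have {}h : 85 / (10 * 10) <= w.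
  apply: le_trans h; rewrite ler_pdivlMr ?exprn_gt0 //.
  have t0 : (10 : R) != 0 by rewrite pnatr_eq0.
  rewrite (exprD _ 2 3) expr2 mulrA divfK ?mulf_neq0 //.
  by rewrite lerDl ler0n.
have {}h : 17 / 20 <= w by lra.
have w2 : 17 / 20 * (17 / 20) <= w * w by nra.
split; first by itv_lra.
by rewrite (expr2 w); nra.
Qed.

Local Open Scope sesquilinear_scope.
Local Notation conjC := Num.conj.
Local Notation "M ^^*" := (map_mx conjC M) (at level 30) : ring_scope.

(** * Takagi factorization *)

Section Takagi.
Variable C : numClosedFieldType.

Lemma trmxCZ m n (a : C) (A : 'M[C]_(m, n)) : (a *: A)^t* = a^* *: A^t*.
Proof. by apply/matrixP => i j; rewrite !mxE rmorphM. Qed.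

Lemma map_conjZ m n (a : C) (A : 'M[C]_(m, n)) : (a *: A)^^* = a^* *: A^^*.
Proof. by apply/matrixP => i j; rewrite !mxE rmorphM. Qed.

Lemma map_conjK m n (A : 'M[C]_(m, n)) : A^^*^^* = A.
Proof. by apply/matrixP => i j; rewrite !mxE conjCK. Qed.

Lemma normCv_ge0 n (v : 'cV[C]_n) : 0 <= (v^t* *m v) 0 0.
Proof. by rewrite mxE; apply: sumr_ge0 => i _; rewrite !mxE mulrC -normCK exprn_ge0. Qed.

Lemma normCv_eq0 n (v : 'cV[C]_n) : ((v^t* *m v) 0 0 == 0) = (v == 0).
Proof.
rewrite mxE psumr_eq0 => [|i _]; last by rewrite !mxE mulrC -normCK exprn_ge0.
apply/allP/eqP => [h|-> i _]; last by rewrite /= !mxE mulr0 eqxx.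
apply/matrixP => i j; rewrite ord1 mxE; apply/eqP.
have := h i (mem_index_enum i).
by rewrite /= !mxE mulrC -normCK expf_eq0 normr_eq0.
Qed.

(* From an eigenvector x of conj(T) T, with eigenvalue l^2, the vector
   conj(T x) + l x is coneigen for T; if it vanishes, so is i x. *)
Lemma coneigenvector n (T : 'M[C]_n.+1) : T^T = T ->
  exists (z : 'cV[C]_n.+1) (l : C),
    [/\ (z^t* *m z) 0 0 = 1, 0 <= l & T *m z = l *: z^^*].
Proof.
move=> symT; set A := T^^* *m T.
(* Eigenvectors are rows here; a row eigenvector of the transpose is a column eigenvector of [A]. *)
have [mu /eigenvalueP[u uA u0]] := @eigenvalue_closed C _ A^T isT.
pose x := u^T.
have x0 : x != 0 by apply: contra u0 => /eqP e; rewrite -(trmxK u) -/x e trmx0.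
have Ax : A *m x = mu *: x.
  by rewrite -[A]trmxK -trmx_mul uA linearZ.
have xx0 : 0 < (x^t* *m x) 0 0 by rewrite lt0r normCv_eq0 x0 normCv_ge0.
(* By symmetry [T^^*] is the adjoint of [T], so mu |x|^2 = |T x|^2. *)
have mu0 : 0 <= mu.
  have : 0 <= ((T *m x)^t* *m (T *m x)) 0 0 by exact: normCv_ge0.
  rewrite trmx_mul map_mxM symT -mulmxA [X in _ *m X]mulmxA -/A Ax.
  by rewrite -scalemxAr mxE pmulr_lge0.
pose l := sqrtC mu; have l0 : 0 <= l by rewrite sqrtC_ge0.
have ll : l * l = mu by rewrite -expr2 sqrtCK.
have lr : l^* = l by apply/CrealP/ger0_real.
suff [z z0 Tz] : exists2 z : 'cV[C]_n.+1, z != 0 & T *m z = l *: z^^*.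
  pose N := (z^t* *m z) 0 0.
  have N0 : 0 < N by rewrite lt0r normCv_eq0 z0 normCv_ge0.
  pose s := (sqrtC N)^-1.
  have sr : s^* = s by apply/CrealP/ger0_real; rewrite invr_ge0 sqrtC_ge0 ltW.
  exists (s *: z), l; split => //.
    rewrite trmxCZ sr -scalemxAl -scalemxAr scalerA mxE -/N.
    by rewrite -{1}(sqrtCK N) expr2 /s; field; rewrite sqrtC_eq0 gt_eqF.
  by rewrite -scalemxAr Tz map_conjZ sr !scalerA mulrC.
have TTx : T *m (T *m x)^^* = mu *: x^^*.
  have mur : mu^* = mu by apply/CrealP/ger0_real.
  rewrite map_mxM mulmxA; move: (congr1 (map_mx conjC) Ax).
  by rewrite map_conjZ mur => <-; rewrite /A !map_mxM map_conjK.
have [z0|z0] := eqVneq ((T *m x)^^* + l *: x) 0; last first.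
  exists ((T *m x)^^* + l *: x) => //.
  rewrite mulmxDr TTx -scalemxAr map_mxD map_conjZ lr scalerDr scalerA ll addrC.
  congr (_ + _); congr (_ *: _).
  by rewrite map_conjK.
exists ('i *: x); first by rewrite scaler_eq0 negb_or neq0Ci.
have : (T *m x) = - l *: x^^*.
  move: z0 => /(congr1 (map_mx conjC)).
  rewrite map_mxD map_conjZ lr raddf0 => /eqP; rewrite addr_eq0 => /eqP.
  rewrite scaleNr => <-.
  by rewrite map_conjK.
by rewrite -scalemxAr => ->; rewrite map_conjZ !scalerA conjCi !mulrN mulrC.
Qed.

(** Gram-Schmidt on a matrix with first row [z^T] gives a unitary matrix whose first row is [z^T] up
    to a factor. Both rows have norm 1, so the factor is a phase, and the whole matrix may be
    multiplied by it. *)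
Lemma unit_col_unitary n (z : 'cV[C]_n.+1) : (z^t* *m z) 0 0 = 1 ->
  exists2 Q : 'M[C]_n.+1, Q \is unitarymx & col 0 Q = z.
Proof.
move=> z1.
pose A : 'M[C]_n.+1 := \matrix_i (if i == 0 then z^T else 0).
have A0 : row 0 A = z^T by rewrite rowK eqxx.
pose S := schmidt A.
have Su : S \is unitarymx by apply: schmidt_unitarymx.
have /sub_rVP[c cE] : (row 0 A <= row 0 S)%MS.
  apply: submx_trans (row_schmidt_sub A 0) _.
  apply/sumsmx_subP => k; rewrite leqn0 => k0.
  have -> : k = 0 by apply/val_inj/eqP.
  by rewrite genmxE submx_refl.
have S0 : (row 0 S *m (row 0 S)^t*) 0 0 = 1.
  transitivity ((S *m S^t*) 0 0); last by rewrite (unitarymxP Su) mxE eqxx.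
  by rewrite !mxE; apply: eq_bigr => i _; rewrite !mxE.
have cc : c * c^* = 1.
  have : (z^T *m (z^T)^t*) 0 0 = 1.
    rewrite -[RHS]z1 !mxE; apply: eq_bigr => i _; rewrite !mxE; exact: mulrC.
  rewrite -A0 cE trmxCZ -scalemxAl -scalemxAr !mxE.
  by move: S0; rewrite !mxE => ->; rewrite mulr1.
exists (c *: S)^T; last first.
  by rewrite -tr_row linearZ /= -cE A0 trmxK.
rewrite trmx_unitary; apply/unitarymxP.
by rewrite trmxCZ -scalemxAl -scalemxAr scalerA cc scale1r; apply/unitarymxP.
Qed.

(** Induction on the size. If the first column of the unitary [Q] is a coneigenvector, the first
    column of [Q^T *m T *m Q] is l times the first basis vector. By symmetry so is the first row,
    and a smaller symmetric block remains. *)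
Theorem Takagi n (T : 'M[C]_n) : T^T = T ->
  exists (U : 'M[C]_n) (d : 'rV[C]_n), [/\ U \is unitarymx,
    forall i, 0 <= d 0 i & U^T *m T *m U = diag_mx d].
Proof.
elim: n T => [|n IH] T symT.
  exists 1%:M, 0; split; last by apply/matrixP; case.
    by apply/unitarymxP; rewrite trmx1 map_mx1 mulmx1.
  by case.
have [z [l [z1 l0 Tz]]] := coneigenvector symT.
have [Q Qu Qz] := unit_col_unitary z1.
have QQ : Q^t* *m Q = 1%:M by apply/mulmx1C/unitarymxP.
pose T1 : 'M[C]_(1 + n) := Q^T *m T *m Q.
have symT1 : T1^T = T1 by rewrite /T1 !trmx_mul trmxK symT mulmxA.
have T10 i : T1 i 0 = l *+ (i == 0).
  have colT1 : col 0 (Q^T *m T *m Q) = Q^T *m (T *m col 0 Q).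
    by rewrite !colE !mulmxA.
  have -> : T1 i 0 = (col 0 (Q^T *m T *m Q)) i 0 by rewrite [RHS]mxE.
  rewrite colT1.
  rewrite Qz Tz -scalemxAr [LHS]mxE -Qz.
  have -> : Q^T *m (col 0 Q)^^* = (col 0 (Q^t* *m Q))^^*.
    by rewrite !colE -mulmxA [RHS]map_mxM map_conjK.
  by rewrite QQ !mxE rmorph_nat mulr_natr.
have T1def : Q^T *m T *m Q = T1 by [].
clearbody T1.
pose T' := drsubmx T1.
have T1E : T1 = block_mx l%:M 0 0 T'.
  rewrite -[LHS]submxK; congr block_mx.
  - apply/matrixP => i j; rewrite !ord1 !mxE.
    by have := T10 0; rewrite eqxx mulr1n => <-; congr (T1 _ _); apply/val_inj.
  - apply/matrixP => i j; rewrite ord1 !mxE -symT1 mxE.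
    have := T10 (rshift 1 j); rewrite mulr0n => <-.
    by congr (T1 _ _); apply/val_inj.
  - apply/matrixP => i j; rewrite ord1 !mxE.
    have := T10 (rshift 1 i); rewrite mulr0n => <-.
    by congr (T1 _ _); apply/val_inj.
have /IH[U' [d' [U'u d'0 U'E]]] : T'^T = T'.
  by rewrite /T' -[in RHS]symT1 trmx_drsub.
pose V : 'M[C]_(1 + n) := block_mx 1%:M 0 0 U'.
have Vu : V \is unitarymx.
  apply/unitarymxP; rewrite /V tr_block_mx map_block_mx mulmx_block.
  rewrite !trmx0 !map_mx0 trmx1 map_mx1 !mulmx0 !mul0mx !addr0 !add0r mulmx1.
  by rewrite (unitarymxP U'u) -scalar_mx_block.
exists (Q *m V), (row_mx l%:M d'); split.
- exact: mul_unitarymx.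
- move=> i; rewrite mxE; case: splitP => j _; last exact: d'0.
  by rewrite ord1 mxE eqxx mulr1n.
- rewrite trmx_mul.
  have -> : V^T *m Q^T *m T *m (Q *m V) = V^T *m T1 *m V.
    by rewrite -T1def !mulmxA.
  rewrite T1E /V tr_block_mx !mulmx_block.
  rewrite !trmx0 trmx1 !mulmx0 !mul0mx !addr0 !add0r !mulmx1 !mul1mx mul0mx U'E.
  rewrite [RHS](diag_mx_row (l%:M : 'rV_1) d').
  have -> // : diag_mx (l%:M : 'rV_1) = l%:M.
  by apply/matrixP => i j; rewrite !ord1 !mxE.
Qed.


(** With A = P^* D P from the spectral theorem, F = P^* D^(1/2). The eigenvalues are nonnegative as
    values of the form at the eigenvectors. *)
Lemma psd_factor n (A : 'M[C]_n) : A \is hermsymmx ->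
  (forall v : 'cV[C]_n, 0 <= (v^t* *m A *m v) 0 0) ->
  exists F : 'M[C]_n, A = F *m F^t*.
Proof.
move=> hA pA.
have /hermitian_normalmx /orthomx_spectralP AE := hA.
have Pu := spectral_unitarymx A.
move: AE; rewrite (invmx_unitary Pu).
set P := spectralmx A in Pu *; set d := spectral_diag A => AE.
have PP : P *m P^t* = 1%:M by apply/unitarymxP.
have d0 i : 0 <= d 0 i.
  have := pA (P^t* *m delta_mx i 0).
  rewrite AE trmx_mul map_mxM trmxCK.
  rewrite -!mulmxA (mulmxA P) PP mul1mx (mulmxA P) PP mul1mx mul_diag_mx.
  rewrite mxE (bigD1 i) //= big1 => [|j ji]; last first.
    by rewrite !mxE (negPf ji) mulr0 mulr0.
  by rewrite !mxE !eqxx rmorph1 mul1r mulr1 addr0.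
pose D := diag_mx (\row_i sqrtC (d 0 i)).
have DD : D *m D^t* = diag_mx d.
  rewrite tr_diag_mx map_diag_mx mulmx_diag; congr diag_mx.
  apply/matrixP => i j; rewrite !mxE ord1.
  by rewrite /= conj_Creal ?ger0_real ?sqrtC_ge0 // -expr2 sqrtCK.
exists (P^t* *m D); rewrite trmx_mul map_mxM trmxCK.
by rewrite AE -DD !mulmxA.
Qed.

End Takagi.

(** * Pure state decompositions and a symmetric bilinear form *)

Section KetSums.
Variables (C : numClosedFieldType) (m : nat) (Om : 'M[C]_m).
Hypothesis symOm : Om^T = Om.
Implicit Types (x y z : 'cV[C]_m) (s L : seq 'cV[C]_m) (a c t : C).

(** A mixed state is given by a list of unnormalized vectors, whose squared norms are the
    weights. *)
Definition ketsum s : 'M[C]_m := \sum_(x <- s) x *m x^t*.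
(** Bilinear rather than sesquilinear: when [Om] is the spin flip, the modulus of [bil x x] is the
    concurrence of x. *)
Definition bil x y : C := (x^T *m Om *m y) 0 0.
Definition sqn x : C := (x^t* *m x) 0 0.

Lemma bilC x y : bil x y = bil y x.
Proof.
have e (M : 'M[C]_1) : M 0 0 = M^T 0 0 by rewrite mxE.
by rewrite /bil e !trmx_mul trmxK symOm mulmxA.
Qed.

Lemma bilDl x y z : bil (x + y) z = bil x z + bil y z.
Proof. by rewrite /bil linearD /= !mulmxDl mxE. Qed.

Lemma bilZl a x z : bil (a *: x) z = a * bil x z.
Proof. by rewrite /bil linearZ /= -!scalemxAl mxE. Qed.

Lemma bilDr x y z : bil z (x + y) = bil z x + bil z y.
Proof. by rewrite bilC bilDl ![bil z _]bilC. Qed.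

Lemma bilZr a x z : bil z (a *: x) = a * bil z x.
Proof. by rewrite bilC bilZl bilC. Qed.

Lemma bilNr x z : bil z (- x) = - bil z x.
Proof. by rewrite -scaleN1r bilZr mulN1r. Qed.

Lemma ketsum_cons x s : ketsum (x :: s) = x *m x^t* + ketsum s.
Proof. by rewrite /ketsum big_cons. Qed.

Lemma ketsum_cat s1 s2 : ketsum (s1 ++ s2) = ketsum s1 + ketsum s2.
Proof. by rewrite /ketsum big_cat. Qed.

Lemma tr_ketsum s : \tr (ketsum s) = \sum_(x <- s) sqn x.
Proof.
rewrite /ketsum raddf_sum /=; apply: eq_bigr => x _.
by rewrite mxtrace_mulC /mxtrace big_ord1.
Qed.

Lemma ketbraZ a x : (a *: x) *m (a *: x)^t* = (a * a^*) *: (x *m x^t*).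
Proof. by rewrite trmxCZ -scalemxAl -scalemxAr scalerA. Qed.

Lemma mulmx_ketsum k (G : 'M[C]_(m, k)) :
  G *m G^t* = \sum_i col i G *m (col i G)^t*.
Proof.
apply/matrixP => i j; rewrite mxE summxE; apply: eq_bigr => l _.
by rewrite [RHS]mxE big_ord1 !mxE.
Qed.

Definition ketmx s : 'M[C]_(m, size s) := \matrix_(i, j) (s`_j) i 0.

Lemma col_ketmx s i : col i (ketmx s) = s`_i.
Proof. by apply/matrixP => k j; rewrite !mxE ord1. Qed.

Lemma ketmxE s : ketmx s *m (ketmx s)^t* = ketsum s.
Proof.
rewrite mulmx_ketsum /ketsum (big_nth 0) big_mkord.
by apply: eq_bigr => i _; rewrite col_ketmx.
Qed.

Lemma mx_bil k (G : 'M[C]_(m, k)) i j :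
  (G^T *m Om *m G) i j = bil (col i G) (col j G).
Proof.
rewrite /bil !mxE; apply: eq_bigr => l _; rewrite !mxE; congr (_ * _).
by apply: eq_bigr => p _; rewrite !mxE.
Qed.

(** Induction on [L]. If the n members of [s] have a common form value, a further vector y is spread
    as chi = y / sqrt n, and each x in [s] is replaced by (x + chi) / sqrt 2 and (x - chi) / sqrt 2.
    The cross terms cancel in [ketsum], and vanish in [bil] because chi is orthogonal to [s]. The
    last clause carries this orthogonality through the induction. *)
Lemma averaged_decomposition L : pairwise (fun x y => bil x y == 0) L ->
  exists s, [/\ (size s == 0) = (size L == 0), ketsum s = ketsum L,
    forall x, x \in s -> (size s)%:R * bil x x = \sum_(y <- L) bil y y &
    forall z, (forall y, y \in L -> bil y z = 0) ->
      forall x, x \in s -> bil x z = 0].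
Proof.
elim: L => [_|y L IH]; first by exists [::]; split.
rewrite pairwise_cons => /andP[/allP yL /IH[s [szs sE sT sO]]].
(* Spreading y divides by the size of [s], so a list with the single vector y is treated apart. *)
have [L0|L0] := eqVneq (size L) 0.
  move: szs; rewrite L0 eqxx => /eqP/size0nil s0; have -> := size0nil L0.
  exists [:: y]; split => //.
  by move=> x; rewrite inE => /eqP->; rewrite mul1r big_seq1.
have n0 : (size s)%:R != 0 :> C by rewrite pnatr_eq0 szs (negPf L0).
set n : C := (size s)%:R in n0.
have n_ge0 : 0 <= n by exact: ler0n.
pose chi := (sqrtC n)^-1 *: y.
pose c : C := (sqrtC 2)^-1.
have csq : c * c = 2^-1 by rewrite /c -invfM -expr2 sqrtCK.
have c_conj : c^* = c by apply/CrealP/ger0_real; rewrite invr_ge0 sqrtC_ge0.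
have n_conj : (sqrtC n)^-1^* = (sqrtC n)^-1.
  by apply/CrealP/ger0_real; rewrite invr_ge0 sqrtC_ge0.
have chichi : chi *m chi^t* = n^-1 *: (y *m y^t*).
  by rewrite ketbraZ n_conj -invfM -expr2 sqrtCK.
have tchi : bil chi chi = n^-1 * bil y y.
  by rewrite bilZl bilZr mulrA -invfM -expr2 sqrtCK.
have xchi x : x \in s -> bil x chi = 0.
  move=> xs; rewrite bilZr (sO y _ x xs) ?mulr0 // => u uL.
  by rewrite bilC; apply/eqP/yL.
have bc u : bil (c *: u) (c *: u) = 2^-1 * bil u u.
  by rewrite bilZl bilZr mulrA csq.
pose s' := [seq c *: (x + chi) | x <- s] ++ [seq c *: (x - chi) | x <- s].
have szs' : size s' = (2 * size s)%N.
  by rewrite size_cat !size_map mul2n addnn.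
exists s'; split.
- by rewrite szs' muln_eq0 /= szs (negPf L0).
- rewrite ketsum_cat ketsum_cons -sE /ketsum !big_map -big_split /=.
  rewrite [LHS](_ : _ = \sum_(x <- s) (x *m x^t* + chi *m chi^t*)).
    rewrite big_split /= addrC; congr (_ + _).
    rewrite chichi big_const_seq count_predT iter_addr_0 -scaler_nat scalerA.
    by rewrite -/n mulfV // scale1r.
  apply: eq_bigr => x _; rewrite !ketbraZ c_conj csq -scalerDr.
  apply/matrixP => i j; rewrite !mxE !big_ord1 !mxE !rmorphD /= !rmorphN /=.
  by rewrite !rmorphM /=; move: ((sqrtC n)^-1) => r; field.
- move=> x; rewrite mem_cat szs' natrM -/n big_cons => /orP[] /mapP[u us ->].
  + rewrite bc bilDl !bilDr (bilC chi) (xchi u us).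
    by rewrite !tchi -(sT u us) -/n addr0 add0r; field.
  + rewrite bc bilDl !bilDr !bilNr (bilC (- chi)) bilNr.
    rewrite (bilC (- chi) chi) bilNr (xchi u us).
    by rewrite !tchi -(sT u us) -/n; field.
- move=> z h x; rewrite mem_cat.
  have hz u : u \in s -> bil u z = 0.
    by apply: sO => v vL; apply: h; rewrite inE vL orbT.
  have hc : bil chi z = 0 by rewrite bilZl h ?mulr0 // mem_head.
  by move=> /orP[] /mapP[u us ->]; rewrite bilZl bilDl hz // ?[bil (- _) _]bilC
    ?bilNr ?[bil z _]bilC hc ?oppr0 addr0 mulr0.
Qed.

Definition diag_frame k (G : 'M[C]_(m, k)) (d : 'rV[C]_k) :=
  (forall i, 0 <= d 0 i) /\ G^T *m Om *m G = diag_mx d.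

Lemma frame_bil k (G : 'M[C]_(m, k)) d i j : diag_frame G d ->
  bil (col i G) (col j G) = d 0 i *+ (i == j).
Proof. by case=> _ GE; rewrite -mx_bil GE mxE. Qed.

(** The frame is F U, where F has the members of [s] as columns and U is the Takagi unitary of the
    Gram matrix of [bil] on them. The last clause is Wootters' lower bound on the average
    concurrence: the i-th form value is sum_j conj(U_ij)^2 d_j, the triangle inequality isolates one
    index, and the columns of U have norm 1. *)
Lemma diag_frame_exists s : exists (G : 'M[C]_(m, size s)) d,
  [/\ diag_frame G d, G *m G^t* = ketsum s &
   forall i, d 0 i - \sum_(j | j != i) d 0 j <= \sum_(x <- s) `|bil x x|].
Proof.
set F := ketmx s; pose T := F^T *m Om *m F.
have symT : T^T = T by rewrite /T !trmx_mul trmxK symOm mulmxA.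
have [U [d [Uu d0 UE]]] := Takagi symT.
exists (F *m U), d; split.
- by split=> //; rewrite trmx_mul -UE /T !mulmxA.
- rewrite trmx_mul map_mxM mulmxA -(mulmxA F) (unitarymxP Uu) mulmx1.
  exact: ketmxE.
have UU : U^t* *m U = 1%:M by apply/mulmx1C/unitarymxP.
have colU j : \sum_i `|U i j| ^+ 2 = 1.
  have -> : \sum_i `|U i j| ^+ 2 = (U^t* *m U) j j.
    by rewrite mxE; apply: eq_bigr => i _; rewrite !mxE normCK mulrC.
  by rewrite UU mxE eqxx.
have TE : T = U^^* *m diag_mx d *m U^t*.
  rewrite -UE !mulmxA.
  have -> : U^^* *m U^T = 1%:M.
    by rewrite -[LHS]map_conjK map_mxM map_conjK (unitarymxP Uu) map_mx1.
  by rewrite mul1mx -mulmxA (unitarymxP Uu) mulmx1.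
have Tii i : T i i = \sum_j (U i j)^* ^+ 2 * d 0 j.
  rewrite TE mxE; apply: eq_bigr => j _; rewrite mul_mx_diag !mxE expr2; ring.
move=> a; rewrite (big_nth 0) big_mkord.
have -> : \sum_(i < size s) `|bil s`_i s`_i| = \sum_i `|T i i|.
  by apply: eq_bigr => i _; rewrite mx_bil col_ketmx.
apply: (@le_trans _ _ (\sum_i (`|U i a| ^+ 2 * d 0 a -
    \sum_(j | j != a) `|U i j| ^+ 2 * d 0 j))).
  rewrite sumrB -mulr_suml colU mul1r exchange_big /=.
  by rewrite lerD2l lerN2; apply: ler_sum => j _; rewrite -mulr_suml colU mul1r.
apply: ler_sum => i _; rewrite Tii [in leRHS](bigD1 a) //=.
have nU j : `|(U i j)^* ^+ 2 * d 0 j| = `|U i j| ^+ 2 * d 0 j.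
  by rewrite normrM normrX norm_conjC (ger0_norm (d0 j)).
rewrite -nU; apply: (le_trans _ (lerB_normD _ _)).
rewrite lerD2l lerN2; apply: (le_trans (ler_norm_sum _ _ _)).
by apply: ler_sum => j _; rewrite nU.
Qed.

(* A frame whose vectors are given arbitrary phases e_i averages to vectors
   having all the same form value, proportional to sum_i e_i^2 d_i. *)
Lemma frame_average k (G : 'M[C]_(m, k)) d (e : 'I_k -> C) : diag_frame G d ->
  (forall i, `|e i| = 1) -> exists s, ketsum s = G *m G^t* /\
  forall x, x \in s -> (size s)%:R * bil x x = \sum_i e i ^+ 2 * d 0 i.
Proof.
move=> Gd e1; pose L := [seq e i *: col i G | i <- enum 'I_k].
have Lorth : pairwise (fun x y => bil x y == 0) L.
  rewrite /L pairwise_map.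
  have : uniq (enum 'I_k) by exact: enum_uniq.
  rewrite uniq_pairwise; apply: sub_pairwise => i j ij.
  by rewrite /relpre /= bilZl bilZr (frame_bil _ _ Gd) (negPf ij) !mulr0.
have [s [_ sE sT _]] := averaged_decomposition Lorth.
exists s; split.
  rewrite sE /ketsum big_map big_enum /= mulmx_ketsum; apply: eq_bigr => i _.
  by rewrite ketbraZ -normCK e1 expr1n scale1r.
move=> x /sT ->; rewrite big_map big_enum /=; apply: eq_bigr => i _.
by rewrite bilZl bilZr (frame_bil _ _ Gd) eqxx mulr1n mulrA expr2.
Qed.

End KetSums.

(** * Closing a polygon of given side lengths in the complex plane *)

Section Polygon.
Variable C : numClosedFieldType.

(** The law of cosines gives the cosine x of the angle between the sides r and a, and u = x + i
    sqrt(1 - x^2). Then |r - u a| = b, and v is the phase of r - u a. Sides of length 0 are treated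
    apart. *)
Lemma triangle_phases (a b r : C) : 0 <= a -> 0 <= b -> 0 <= r ->
  r <= a + b -> a <= r + b -> b <= a + r ->
  exists u v : C, [/\ `|u| = 1, `|v| = 1 & u * a + v * b = r].
Proof.
move=> a0 b0 r0 rab arb bar.
have [r_0|r_neq0] := eqVneq r 0.
  exists 1, (-1); rewrite normrN1 normr1; split => //.
  have -> : a = b.
    by apply/eqP; rewrite eq_le; move: arb bar; rewrite r_0 add0r addr0 => -> ->.
  by rewrite r_0 mul1r mulN1r subrr.
have [a_0|a_neq0] := eqVneq a 0.
  exists 1, 1; rewrite normr1; split => //.
  have -> : r = b.
    by apply/eqP; rewrite eq_le; move: rab bar; rewrite a_0 !add0r => -> ->.
  by rewrite a_0 mulr0 add0r mul1r.
pose x := (r ^+ 2 + a ^+ 2 - b ^+ 2) / (2 * (r * a)).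
have n2 : (2 : C) != 0 by rewrite pnatr_eq0.
have xr : x \is Num.real.
  by rewrite !(realM, realV, realD, realN, realX) ?realn ?ger0_real.
(* As in Heron's formula, the numerator factors into r + a + b and the three defects of the triangle
   inequality. *)
have x2 : 0 <= 1 - x ^+ 2.
  have -> : 1 - x ^+ 2 = (r + a - b) * (r + a + b) * ((b - r + a) * (b + r - a))
      / (2 * (r * a)) ^+ 2.
    by rewrite /x; field; rewrite ?r_neq0 ?a_neq0.
  have h1 : 0 <= r + a - b by rewrite subr_ge0 addrC.
  have h2 : 0 <= b - r + a by rewrite addrAC subr_ge0 addrC.
  have h3 : 0 <= b + r - a by rewrite subr_ge0 addrC.
  have h4 : 0 <= r + a + b by rewrite !addr_ge0.
  have h5 : 0 <= 2 * (r * a) by rewrite mulr_ge0 ?ler0n // mulr_ge0.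
  apply: divr_ge0; last exact: exprn_ge0.
  by apply: mulr_ge0; apply: mulr_ge0.
pose y := sqrtC (1 - x ^+ 2).
have yr : y \is Num.real by rewrite ger0_real ?sqrtC_ge0.
have y2 : y ^+ 2 = 1 - x ^+ 2 by rewrite sqrtCK.
pose u := x + 'i * y.
have u1 : `|u| = 1.
  apply/eqP; rewrite -(@pexpr_eq1 _ _ 2) ?normr_ge0 //.
  by rewrite normC2_rect // y2 addrC subrK.
have w2 : `|r - u * a| ^+ 2 = b ^+ 2.
  have -> : r - u * a = (r - x * a) + 'i * (- (y * a)) by rewrite /u; ring.
  have [rr ar] := (ger0_real r0, ger0_real a0).
  rewrite normC2_rect; [|by rewrite realB // realM|by rewrite realN realM].
  have -> : (r - x * a) ^+ 2 + (- (y * a)) ^+ 2 =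
    r ^+ 2 - 2 * (r * a) * x + (x ^+ 2 + y ^+ 2) * a ^+ 2 by ring.
  by rewrite y2 /x; field; rewrite ?r_neq0 ?a_neq0.
have wb : `|r - u * a| = b.
  by apply/eqP; rewrite -(@eqrXn2 _ 2) ?normr_ge0 // w2.
have [b_0|b_neq0] := eqVneq b 0.
  exists u, 1; rewrite normr1; split => //; rewrite mul1r b_0 addr0.
  by move: wb; rewrite b_0 => /eqP; rewrite normr_eq0 subr_eq0 => /eqP.
exists u, ((r - u * a) / b); split => //.
  by rewrite normrM normfV wb (ger0_norm b0) mulfV.
by rewrite divfK // addrC subrK.
Qed.

(** Induction on the sides: a first side d_a, the resultant r' of the others and r must form a
    triangle. The choice r' = min(r + d_a, S), with S the sum of the other sides, meets the triangle
    inequalities and the induction hypothesis. *)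
Lemma polygon_phases (I : eqType) (s : seq I) (d : I -> C) (r : C) :
  uniq s -> (forall i, 0 <= d i) -> 0 <= r -> r <= \sum_(i <- s) d i ->
  (forall i, i \in s -> 2 * d i <= \sum_(i <- s) d i + r) ->
  exists u : I -> C, (forall i, `|u i| = 1) /\ \sum_(i <- s) u i * d i = r.
Proof.
move=> us d0; elim: s us r => [_ r r0|a s IH /andP[a_s us] r r0].
  rewrite !big_nil => r1 _; exists (fun=> 1); split; first by rewrite normr1.
  by rewrite big_nil; apply/eqP; rewrite eq_le r0 r1.
rewrite !big_cons => rs h.
set S := \sum_(i <- s) d i in rs h *.
have S0 : 0 <= S by rewrite /S sumr_ge0.
have [r' [/andP[r'0 r'S] r'ra rar' arr' hs]] : exists r',
    [/\ 0 <= r' <= S, r' <= r + d a, r <= d a + r' , d a <= r + r' &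
    forall i, i \in s -> 2 * d i <= S + r'].
  have /orP[hS|hS] : (r + d a <= S) || (S <= r + d a).
    by apply: real_leVge; rewrite ger0_real // addr_ge0.
    exists (r + d a); rewrite addr_ge0 // hS lexx; split=> //.
    - by rewrite addrCA lerDl addr_ge0.
    - by rewrite addrA lerDr addr_ge0.
    - move=> i is_; have := h i _; rewrite inE is_ orbT => /(_ isT).
      by rewrite [r + _]addrC addrA [S + _]addrC.
  exists S; rewrite S0 lexx; split=> //.
  - have := h a (mem_head _ _).
    by rewrite mulr_natl mulr2n -addrA lerD2l addrC.
  - move=> i is_; rewrite mulr_natl mulr2n.
    have hi : d i <= S by rewrite /S (big_rem i) //= lerDl sumr_ge0.
    exact: lerD.
have [u [u1 uE]] := IH us r' r'0 r'S hs.
have [p [q [p1 q1 pq]]] : exists p q : C,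
    [/\ `|p| = 1, `|q| = 1 & p * d a + q * r' = r].
  by apply: triangle_phases => //; rewrite addrC.
exists (fun i => if i == a then p else q * u i); split.
  by move=> i; case: ifP => // _; rewrite normrM q1 u1 mulr1.
rewrite big_cons eqxx -pq -uE mulr_sumr; congr (_ + _).
apply: eq_big_seq => i is_; case: eqP => [ia|_]; last by rewrite mulrA.
by move: a_s; rewrite -ia is_.
Qed.

End Polygon.

Lemma sum0_has_pos (C : numClosedFieldType) (T : eqType) (f : T -> C)
    (s : seq T) (y : T) :
  (forall x, x \in s -> f x \is Num.real) -> \sum_(x <- s) f x = 0 ->
  y \in s -> f y != 0 -> exists2 x, x \in s & 0 < f x.
Proof.
move=> fr f0 ys fy; apply/hasP; apply: contraNT fy => /hasPn npos.
have fle x : x \in s -> 0 <= - f x.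
  by move=> xs; rewrite oppr_ge0 real_leNgt ?real0 ?fr // npos.
have : \sum_(x <- s | x \in s) - f x == 0.
  by rewrite -big_seq sumrN f0 oppr0.
rewrite psumr_eq0 // => /allP/(_ y ys)/implyP/(_ ys).
by rewrite oppr_eq0.
Qed.

(** * Decompositions with prescribed concurrences *)

Section Roof.
Variables (C : numClosedFieldType) (m : nat) (Om : 'M[C]_m).
Hypothesis symOm : Om^T = Om.
Implicit Types (x y z : 'cV[C]_m) (s L : seq 'cV[C]_m) (a b c t : C).
Local Notation bil := (bil Om).

Lemma sqn_real x : sqn x \is Num.real.
Proof. exact/ger0_real/normCv_ge0. Qed.

(** As [a] and [d] have opposite signs, the polynomial a + tau b + tau^2 d has a real root tau, and
    (c, t) is (1, tau) normalized. *)
Lemma real_rotation a b d : a \is Num.real -> b \is Num.real ->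
  0 < a -> d < 0 -> exists c t, [/\ c \is Num.real, t \is Num.real,
    c ^+ 2 + t ^+ 2 = 1 & c ^+ 2 * a + c * t * b + t ^+ 2 * d = 0].
Proof.
move=> ar br a0 d0; have dr : d \is Num.real by exact: ltr0_real.
have dn0 : d != 0 by rewrite lt_eqF.
have D0 : 0 <= b ^+ 2 - 4 * (a * d).
  rewrite addr_ge0 ?real_exprn_even_ge0 // oppr_ge0 pmulr_rle0 ?ltr0n //.
  by rewrite pmulr_rle0 // ltW.
pose q := sqrtC (b ^+ 2 - 4 * (a * d)).
have qr : q \is Num.real by rewrite ger0_real // sqrtC_ge0.
have q2 : q ^+ 2 = b ^+ 2 - 4 * (a * d) by rewrite sqrtCK.
pose tau := (- b - q) / (2 * d).
have tr : tau \is Num.real.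
  by rewrite realM ?realV ?realB ?realN ?realM ?realn.
have tau0 : a + tau * b + tau ^+ 2 * d = 0.
  have -> : a + tau * b + tau ^+ 2 * d = (q ^+ 2 - (b ^+ 2 - 4 * (a * d))) / (4 * d).
    by rewrite /tau; field; rewrite ?dn0.
  by rewrite q2 subrr mul0r.
have n0 : 0 < 1 + tau ^+ 2.
  by rewrite (@lt_le_trans _ _ 1) ?ltr01 // lerDl real_exprn_even_ge0.
pose c := (sqrtC (1 + tau ^+ 2))^-1.
have c2 : c ^+ 2 = (1 + tau ^+ 2)^-1 by rewrite exprVn sqrtCK.
have cr : c \is Num.real by rewrite realV ger0_real // sqrtC_ge0 ltW.
exists c, (c * tau); split => //; first exact: realM.
  by rewrite exprMn c2 -{1}[_^-1]mulr1 -mulrDr mulVf // gt_eqF.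
have -> : c ^+ 2 * a + c * (c * tau) * b + (c * tau) ^+ 2 * d =
  c ^+ 2 * (a + tau * b + tau ^+ 2 * d) by ring.
by rewrite tau0 mulr0.
Qed.

Lemma sqn_comb a b x z : a \is Num.real -> b \is Num.real ->
  sqn (a *: x + b *: z) = a ^+ 2 * sqn x +
    a * b * ((x^t* *m z) 0 0 + (z^t* *m x) 0 0) + b ^+ 2 * sqn z.
Proof.
move=> ar br; have e (u v : 'cV[C]_m) : (u + v)^t* = u^t* + v^t*.
  by rewrite linearD /= map_mxD.
rewrite /sqn e !trmxCZ !mulmxDl !mulmxDr -!scalemxAl -!scalemxAr !conj_Creal //.
have eD (A B : 'M[C]_1) : (A + B) 0 0 = A 0 0 + B 0 0 by rewrite mxE.
have eZ k (A : 'M[C]_1) : (k *: A) 0 0 = k * A 0 0 by rewrite mxE.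
by rewrite !(eD, eZ); ring.
Qed.

Lemma bil_comb a b x z :
  bil (a *: x + b *: z) (a *: x + b *: z) = a ^+ 2 * bil x x +
    a * b * (2 * bil x z) + b ^+ 2 * bil z z.
Proof.
by rewrite bilDl !(bilDr symOm) !bilZl !(bilZr symOm) (bilC symOm z x); ring.
Qed.

(* Rotating a vector with positive defect [bil x x - t * sqn x] against one
   with negative defect makes one of the two defects vanish. *)
Lemma equalize t L : t \is Num.real ->
  (forall x y, x \in L -> y \in L -> bil x y \is Num.real) ->
  \sum_(x <- L) (bil x x - t * sqn x) = 0 ->
  exists s, ketsum s = ketsum L /\ forall x, x \in s -> bil x x = t * sqn x.
Proof.
move=> tr; pose f x := bil x x - t * sqn x.
have [n] := ubnP (size L); elim: n L => // n IH L szL Lr L0.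
have fr x : x \in L -> f x \is Num.real.
  by move=> xL; rewrite realB ?realM ?sqn_real ?Lr.
have ksP s1 s2 : perm_eq s1 s2 -> ketsum s1 = ketsum s2.
  by move=> h; rewrite /ketsum (perm_big _ h).
have [/hasP[x xL /eqP fx]|/hasPn nf] := boolP (has (fun x => f x == 0) L).
  have pL := perm_to_rem xL.
  have [|||s [sE sT]] := IH (rem x L).
  - by rewrite size_rem // -ltnS prednK //; case: (L) xL.
  - by move=> u v /mem_rem uL /mem_rem vL; apply: Lr.
  - by move: L0; rewrite (perm_big _ pL) big_cons /= (fx : bil x x - _ = 0) add0r.
  exists (x :: s); rewrite ketsum_cons sE -ketsum_cons (ksP _ _ pL); split => //.
  move=> u; rewrite inE => /predU1P[->|/sT //].
  by apply/eqP; rewrite -subr_eq0; apply/eqP.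
case: L => [|v L'] in szL Lr L0 fr nf *; first by exists [::].
set L := v :: L' in szL Lr L0 fr nf *.
have vL : v \in L by exact: mem_head.
have [x xL fx] := sum0_has_pos fr L0 vL (nf _ vL).
have [z zL fz] : exists2 z, z \in L & 0 < - f z.
  apply: (@sum0_has_pos _ _ (fun z => - f z) L v) => //.
  - by move=> u uL; rewrite realN fr.
  - by rewrite sumrN L0 oppr0.
  - by rewrite oppr_eq0 nf.
rewrite oppr_gt0 in fz.
have zx : z != x by apply/eqP => e; move: fz; rewrite e lt_gtF.
have zL' : z \in rem x L.
  have := perm_mem (perm_to_rem xL) z.
  by rewrite zL inE (negPf zx) /= => <-.
pose M := rem z (rem x L).
have pL : perm_eq L [:: x, z & M].
  apply: perm_trans (perm_to_rem xL) _; rewrite perm_cons.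
  exact: perm_to_rem.
have ML u : u \in M -> u \in L by move=> /mem_rem/mem_rem.
pose b := 2 * bil x z - t * ((x^t* *m z) 0 0 + (z^t* *m x) 0 0).
have br : b \is Num.real.
  have zxE : (z^t* *m x) 0 0 = ((x^t* *m z) 0 0)^*.
    rewrite !mxE rmorph_sum; apply: eq_bigr => i _.
    by rewrite !mxE rmorphM /= conjCK mulrC.
  rewrite /b zxE realB ?realM ?realn ?Lr //.
  by apply/CrealP; rewrite rmorphD /= conjCK addrC.
have [c [d [cr dr cd1 cd0]]] := real_rotation (fr _ xL) br fx fz.
have fcomb p q : p \is Num.real -> q \is Num.real ->
    f (p *: x + q *: z) = p ^+ 2 * f x + p * q * b + q ^+ 2 * f z.
  by move=> pr qr; rewrite /f bil_comb sqn_comb // /b; ring.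
(* A real rotation keeps the sum of the two ketbras and the sum of the two defects. The vector x',
   of defect 0, leaves the list; z' stays in it. *)
pose x' := c *: x + d *: z; pose z' := (- d) *: x + c *: z.
have fx' : f x' = 0 by rewrite fcomb.
have fxz : f x' + f z' = f x + f z.
  rewrite !fcomb ?realN //.
  rewrite -[RHS]mulr1 -cd1; ring.
have kxz : x' *m x'^t* + z' *m z'^t* = x *m x^t* + z *m z^t*.
  have cc := conj_Creal cr; have dd := conj_Creal dr.
  apply/matrixP => i j; rewrite !mxE !big_ord1 !mxE !rmorphD !rmorphM /= rmorphN /=.
  rewrite cc dd -[RHS]mulr1 -cd1; ring.
have xzr u w : u \in L -> w \in L -> bil u w \is Num.real by apply: Lr.
have bz' u : u \in L -> bil z' u \is Num.real.
  by move=> uL; rewrite bilDl !bilZl realD ?realM ?realN ?xzr.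
have szM : (size (z' :: M) < n)%N.
  by move: szL; rewrite (perm_size pL).
have [||s [sE sT]] := IH (z' :: M) szM.
- move=> u w; rewrite !inE => /predU1P[->|uM] /predU1P[->|wM].
  + rewrite (bilDr symOm) !(bilZr symOm).
    by apply: realD; apply: realM; rewrite ?realN ?bz'.
  + exact/bz'/ML.
  + by rewrite (bilC symOm); apply/bz'/ML.
  + by apply: Lr; exact: ML.
- move: L0; rewrite (perm_big _ pL) !big_cons /= addrA.
  by rewrite -[X in X + _ = 0]/(f x + f z) -fxz fx' add0r.
exists (x' :: s); rewrite ketsum_cons sE ketsum_cons addrA kxz.
rewrite (ksP _ _ pL) !ketsum_cons addrA; split => // u.
rewrite inE => /predU1P[->|/sT //].
by apply/eqP; rewrite -subr_eq0; apply/eqP.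
Qed.

(** For the case where [d 0 i] exceeds the sum of the other values: the phase 'i changes the sign of
    a form value, so the total becomes [d 0 i] minus the others. *)
Lemma signed_phases k (G : 'M[C]_(m, k)) d i : diag_frame Om G d ->
  exists e : 'I_k -> C, (forall j, `|e j| = 1) /\
    forall j, e j ^+ 2 = (if j == i then 1 else -1).
Proof.
move=> _; exists (fun j => if j == i then 1 else 'i); split=> j.
  by case: ifP => _; rewrite ?normr1 ?normCi.
by case: ifP => _; rewrite ?expr1n ?sqrCi.
Qed.

Lemma sum_signs k (d : 'rV[C]_k) (e : 'I_k -> C) i :
  (forall j, e j ^+ 2 = (if j == i then 1 else -1)) ->
  \sum_j e j ^+ 2 * d 0 j = d 0 i - \sum_(j | j != i) d 0 j.
Proof.
move=> eE; rewrite (bigD1 i) //= eE eqxx mul1r; congr (_ + _).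
rewrite -sumrN; apply: eq_bigr => j ji.
by rewrite eE (negPf ji) mulN1r.
Qed.

(** No side exceeds the sum of the others, so the sides close up to a polygon. Phases enter the form
    squared, whence the square roots. *)
Lemma cancelling_phases k (d : 'rV[C]_k) : (forall i, 0 <= d 0 i) ->
  (forall i, d 0 i <= \sum_(j | j != i) d 0 j) ->
  exists e : 'I_k -> C, (forall j, `|e j| = 1) /\
    \sum_j e j ^+ 2 * d 0 j = 0.
Proof.
move=> d0 dle.
have [||u [u1 uE]] := @polygon_phases C _ (enum 'I_k) (d 0) 0
  (enum_uniq _) d0 (lexx 0).
- by rewrite sumr_ge0.
- move=> i _; rewrite big_enum /= addr0 (bigD1 i) //= mulr_natl mulr2n.
  by rewrite lerD2l.
exists (fun j => sqrtC (u j)); split=> [j|].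
  by apply/eqP; rewrite -(@pexpr_eq1 _ _ 2) // -normrX sqrtCK u1.
by rewrite -[RHS]uE big_enum /=; apply: eq_bigr => j _; rewrite sqrtCK.
Qed.

(** A bound on the convex roof of |bil x x|, given by a witness instead of a minimum. No trace is
    prescribed for S, which makes the bound additive. *)
Definition roof_le (S : 'M[C]_m) c := exists s,
  ketsum s = S /\ \sum_(x <- s) `|bil x x| <= c.

Lemma roof_leD S1 S2 c1 c2 : roof_le S1 c1 -> roof_le S2 c2 ->
  roof_le (S1 + S2) (c1 + c2).
Proof.
move=> [s1 [<- h1]] [s2 [<- h2]]; exists (s1 ++ s2).
by rewrite ketsum_cat big_cat lerD.
Qed.

(** After averaging, all members have the same form value, so the sum of the moduli is the modulus
    of the sum. *)
Lemma frame_roof_le k (G : 'M[C]_(m, k)) d (e : 'I_k -> C) :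
  diag_frame Om G d -> (forall j, `|e j| = 1) ->
  roof_le (G *m G^t*) `|\sum_j e j ^+ 2 * d 0 j|.
Proof.
move=> Gd e1; have [s [sE sT]] := frame_average symOm Gd e1.
exists s; split => //; have [s0|s0] := eqVneq (size s) 0.
  by rewrite (size0nil s0) big_nil normr_ge0.
have n0 : (size s)%:R != 0 :> C by rewrite pnatr_eq0.
rewrite (eq_big_seq (fun=> `|\sum_j e j ^+ 2 * d 0 j| / (size s)%:R)).
  by rewrite big_const_seq count_predT iter_addr_0 -[X in X <= _]mulr_natr divfK.
move=> x /sT <-; rewrite normrM normr_nat.
by rewrite mulrAC mulfV // mul1r.
Qed.

(* Wootters' argument: all the members of the new decomposition have at most the
   average concurrence of the given one. *)
Theorem equal_concurrence s0 c : \tr (ketsum s0) = 1 ->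
  \sum_(x <- s0) `|bil x x| <= c ->
  exists s, ketsum s = ketsum s0 /\ forall x, x \in s -> `|bil x x| <= c * sqn x.
Proof.
move=> tr1 hc; have [G [d [Gd GE dle]]] := diag_frame_exists symOm s0.
have c0 : 0 <= c by apply: le_trans hc; rewrite sumr_ge0.
have d0 := Gd.1; have dr i : d 0 i \is Num.real by rewrite ger0_real.
(* If no value exceeds the sum of the others, the form values can be cancelled and every member gets
   concurrence 0. Otherwise the signed phases give the total t > 0. *)
have [/existsP[i hi]|] :=
    boolP [exists i, \sum_(j | j != i) d 0 j < d 0 i]; last first.
  rewrite negb_exists => /forallP hd.
  have [i|e [e1 e0]] := cancelling_phases d0.
    by rewrite real_leNgt ?ger0_real // ?sumr_ge0.
  have [s [sE sT]] := frame_average symOm Gd e1.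
  exists s; rewrite sE GE; split => // x xs.
  have : (size s)%:R * bil x x = 0 by rewrite sT.
  move/eqP; rewrite mulf_eq0 pnatr_eq0 => /orP[/eqP/size0nil s_nil|/eqP ->].
    by move: xs; rewrite s_nil.
  by rewrite normr0 mulr_ge0 // normCv_ge0.
have [e [e1 e2]] := signed_phases i Gd.
pose t := d 0 i - \sum_(j | j != i) d 0 j.
have t0 : 0 <= t by rewrite subr_ge0 ltW.
pose L := [seq e j *: col j G | j <- enum 'I_(size s0)].
have LE : ketsum L = ketsum s0.
  rewrite -GE /ketsum big_map big_enum /= mulmx_ketsum; apply: eq_bigr => j _.
  by rewrite ketbraZ -normCK e1 expr1n scale1r.
(* The defects relative to t sum to 0 because the signed form values sum to t and the trace is 1. *)
have [||s [sE sT]] := @equalize t L (ger0_real t0).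
- move=> x y /mapP[j _ ->] /mapP[l _ ->].
  rewrite bilZl (bilZr symOm) (frame_bil _ _ Gd).
  have [->|jl] := eqVneq j l; last by rewrite mulr0 !mulr0.
  by rewrite mulr1n mulrA -expr2 e2 realM //; case: ifP; rewrite ?realN ?real1.
- rewrite sumrB -mulr_sumr -tr_ketsum LE tr1 mulr1 big_map big_enum /=.
  rewrite (eq_bigr (fun j => e j ^+ 2 * d 0 j)).
    by rewrite (sum_signs _ e2) subrr.
  by move=> j _; rewrite bilZl (bilZr symOm) (frame_bil _ _ Gd) eqxx mulr1n mulrA.
exists s; rewrite sE LE; split => // x /sT ->.
rewrite normrM (ger0_norm t0) (ger0_norm (normCv_ge0 x)).
by rewrite ler_wpM2r ?normCv_ge0 // (le_trans (dle i)).
Qed.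

End Roof.

(** * Measuring one qubit of a two-qubit state *)

Section HermitianPencil.
Variable C : numClosedFieldType.
Implicit Types (x y h : C * C).

Definition wedge x y : C := x.1 * y.2 - x.2 * y.1.

(* The triple [(al, be, z)] stands for the matrix [[al, z], [z^*, be]]. *)
Definition hform (E : C * C * C) x : C :=
  let: (al, be, z) := E in al * (x.1 * x.1^*) + be * (x.2 * x.2^*) +
    (z * x.1^* * x.2 + (z * x.1^* * x.2)^*).

Definition indefinite (E : C * C * C) : Prop :=
  let: (al, be, z) := E in
  [/\ al \is Num.real, be \is Num.real & al * be - z * z^* < 0].

(* The forms x |-> 2 Re (zeta conj(x ^ b) (a ^ x)) vanish at a and b, and
   zeta is chosen so as to vanish at c. *)
Lemma hform_null3 a b c : wedge a b != 0 -> exists E, [/\ indefinite E,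
  forall x, wedge a x = 0 -> hform E x = 0,
  forall x, wedge x b = 0 -> hform E x = 0 & hform E c = 0].
Proof.
move=> ab.
have [zeta [zeta0 hz]] : exists zeta, zeta != 0 /\
    zeta * (wedge c b)^* * wedge a c + (zeta * (wedge c b)^* * wedge a c)^* = 0.
  have [pq|pq] := eqVneq (wedge c b * (wedge a c)^*) 0.
    exists 1; rewrite oner_eq0; split => //.
    suff -> : 1 * (wedge c b)^* * wedge a c = 0 by rewrite rmorph0 addr0.
    by move/(congr1 Num.conj): pq; rewrite rmorphM /= conjCK rmorph0 mul1r.
  (* This makes the product purely imaginary, so that its real part vanishes. *)
  exists ('i * (wedge c b * (wedge a c)^*)); rewrite mulf_neq0 ?neq0Ci //.
  by split => //; rewrite !rmorphM /= !conjCK conjCi; ring.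
pose s := - (zeta * b.2^* * a.2).
pose t := - (zeta * b.1^* * a.1).
pose z := zeta * b.2^* * a.1 + (zeta * b.1^* * a.2)^*.
exists (s + s^*, t + t^*, z).
have hE x : hform (s + s^*, t + t^*, z) x =
    zeta * (wedge x b)^* * wedge a x + (zeta * (wedge x b)^* * wedge a x)^*.
  rewrite /hform /wedge /s /t /z.
  rewrite !(rmorphM, rmorphD, rmorphN, rmorphB) /=.
  rewrite !conjCK.
  ring.
split.
- split.
  + by apply/CrealP; rewrite rmorphD /= conjCK addrC.
  + by apply/CrealP; rewrite rmorphD /= conjCK addrC.
  + have -> : (s + s^*) * (t + t^*) - z * z^* =
        - ((zeta * zeta^*) * (wedge a b * (wedge a b)^*)).
      rewrite /wedge /s /t /z.
      rewrite !(rmorphM, rmorphD, rmorphN, rmorphB) /= ?conjCK.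
      ring.
    by rewrite oppr_lt0 -!normCK mulr_gt0 // exprn_gt0 // normr_gt0.
- by move=> x ax; rewrite hE ax mulr0 rmorph0 addr0.
- by move=> x xb; rewrite hE xb rmorph0 mulr0 mul0r rmorph0 addr0.
- by rewrite hE.
Qed.

Lemma wedge_perp x : x != (0, 0) -> exists y, wedge x y != 0.
Proof.
case: x => u v; rewrite xpair_eqE negb_and => /orP[u0|v0].
  by exists (0, 1); rewrite /wedge /= mulr1 mulr0 subr0.
by exists (1, 0); rewrite /wedge /= mulr1 mulr0 sub0r oppr_eq0.
Qed.

Lemma wedgexx x : wedge x x = 0.
Proof. by rewrite /wedge mulrC subrr. Qed.

Lemma wedgex0 x : wedge x (0, 0) = 0.
Proof. by rewrite /wedge !mulr0 subrr. Qed.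

Lemma wedgeC x y : wedge x y = - wedge y x.
Proof. by rewrite /wedge; ring. Qed.

(** The null directions of an indefinite hermitian form are a circle of the projective line, and a
    circle passes through any three points; [h0] and [h1] account for at most one point. The cases
    sort out vanishing and proportional vectors, to find the independent pair that [hform_null3]
    requires. *)
Lemma hform_null4 h0 h1 h2 h3 : wedge h0 h1 = 0 ->
  exists E, indefinite E /\
  [/\ hform E h0 = 0, hform E h1 = 0, hform E h2 = 0 & hform E h3 = 0].
Proof.
move=> h01.
(* The vector k spans the common direction of [h0] and [h1]; it is zero only if both are. *)
have [k [k0 k1 kN]] : exists k, [/\ wedge k h0 = 0, wedge k h1 = 0 &
    k = (0, 0) -> h0 = (0, 0) /\ h1 = (0, 0)].
  have [h1_0|h1_0] := eqVneq h1 (0, 0).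
    by exists h0; rewrite wedgexx h01 h1_0.
  exists h1; rewrite wedgexx wedgeC h01 oppr0; split=> // e.
  by move: h1_0; rewrite e eqxx.
have [k2|k2] := eqVneq (wedge k h2) 0; last first.
  have [E [iE Ea Eb Ec]] := hform_null3 h3 k2.
  exists E; split=> //.
  by split; [exact: Ea | exact: Ea | apply/Eb/wedgexx | exact: Ec].
have [k3|k3] := eqVneq (wedge k h3) 0; last first.
  have [E [iE Ea Eb Ec]] := hform_null3 h2 k3.
  exists E; split=> //.
  by split; [exact: Ea | exact: Ea | exact: Ec | apply/Eb/wedgexx].
have [k_0|k_0] := eqVneq k (0, 0); last first.
  have [b /(hform_null3 (0, 0))[E [iE Ea Eb Ec]]] := wedge_perp k_0.
  by exists E; split=> //; split; apply: Ea.
have [h0_0 h1_0] := kN k_0; rewrite h0_0 h1_0.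
have [h23|h23] := eqVneq (wedge h2 h3) 0; last first.
  have [E [iE Ea Eb Ec]] := hform_null3 (0, 0) h23.
  exists E; split=> //.
  by split; [exact/Ea/wedgex0 | exact/Ea/wedgex0 | exact/Ea/wedgexx | exact/Eb/wedgexx].
have [l [l0 l2 l3]] : exists l, [/\ l != (0, 0), wedge l h2 = 0 & wedge l h3 = 0].
  have [h2_0|h2_0] := eqVneq h2 (0, 0); last by exists h2; rewrite wedgexx.
  have [h3_0|h3_0] := eqVneq h3 (0, 0).
    by exists (1, 0); rewrite h2_0 h3_0 !wedgex0 xpair_eqE oner_eq0.
  by exists h3; rewrite wedgexx h2_0 wedgex0.
have [b /(hform_null3 (0, 0))[E [iE Ea Eb Ec]]] := wedge_perp l0.
exists E; split=> //.
by split; [exact/Ea/wedgex0 | exact/Ea/wedgex0 | exact: Ea | exact: Ea].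
Qed.

Lemma binary_quadratic_root (a b d : C) :
  exists x, x != (0, 0) /\ a * x.1 ^+ 2 + b * (x.1 * x.2) + d * x.2 ^+ 2 = 0.
Proof.
have [->|a0] := eqVneq a 0.
  exists (1, 0); rewrite xpair_eqE oner_eq0; split=> //=.
  by rewrite mul0r !mulr0 expr0n mulr0 !addr0.
pose q := sqrtC (b ^+ 2 - 4 * (a * d)).
exists ((q - b) / (2 * a), 1); split=> /=.
  by rewrite xpair_eqE oner_eq0 andbF.
have -> : a * ((q - b) / (2 * a)) ^+ 2 + b * ((q - b) / (2 * a) * 1) + d * 1 ^+ 2
    = (q ^+ 2 - (b ^+ 2 - 4 * (a * d))) / (4 * a) by field; rewrite a0.
by rewrite sqrtCK subrr mul0r.
Qed.

End HermitianPencil.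

Lemma sum_qubit (V : nmodType) (F : 'I_2 -> V) : \sum_b F b = F 0 + F 1.
Proof.
by rewrite big_ord_recl big_ord1; congr (F _ + F _); apply/val_inj.
Qed.

Definition det2 (C : pzRingType) (M : 'I_2 -> 'I_2 -> C) : C :=
  M 0 0 * M 1 1 - M 0 1 * M 1 0.

Lemma det_mx2 (C : comNzRingType) (M : 'M[C]_2) : \det M = det2 M.
Proof.
rewrite (expand_det_row _ 0) sum_qubit /cofactor !det_mx11 !mxE /det2 /=.
have -> : lift 0 0 = 1 :> 'I_2 by apply/val_inj.
have -> : lift 1 0 = 0 :> 'I_2 by apply/val_inj.
by rewrite expr0 mul1r expr1 mulN1r mulrN.
Qed.

(** Lagrange's identity: twice the Gram determinant is the sum of the squared moduli of the 2 by 2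
    minors. *)
Lemma gram_det_ge0 (C : numClosedFieldType) (I : finType) (u : I -> 'I_2 -> C) :
  0 <= det2 (fun a a' => \sum_i u i a * (u i a')^*).
Proof.
rewrite /det2; set A := \sum_i u i 0 * (u i 0)^*.
set B := \sum_i u i 1 * (u i 1)^*; set X := \sum_i u i 0 * (u i 1)^*.
set Y := \sum_i u i 1 * (u i 0)^*.
have e : \sum_i \sum_j `|u i 0 * u j 1 - u j 0 * u i 1| ^+ 2 =
    2 * (A * B - X * Y).
  transitivity (A * B + B * A - (X * Y + Y * X)); last by ring.
  rewrite !mulr_suml -!big_split -sumrB; apply: eq_bigr => i _ /=.
  rewrite !mulr_sumr -!big_split -sumrB; apply: eq_bigr => j _ /=.
  by rewrite normCK rmorphB !rmorphM /=; ring.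
rewrite -(@pmulr_rge0 _ 2) ?ltr0n // -e.
by rewrite sumr_ge0 // => i _; rewrite sumr_ge0 // => j _; rewrite exprn_ge0.
Qed.

Section Measurement.
Variable C : numClosedFieldType.

(** In an orthogonal basis containing the isotropic vector one diagonal entry is 0, so the
    determinant is minus the squared modulus of an off-diagonal entry. The factor on the left clears
    the normalization. *)
Lemma herm_det_isotropic (a b c x y : C) : a \is Num.real -> b \is Num.real ->
  x * x^* * a + x * y^* * c + y * x^* * c^* + y * y^* * b = 0 ->
  (a * b - c * c^*) * (`|x| ^+ 2 + `|y| ^+ 2) ^+ 2 =
  - `|x * y * (b - a) + x * x * c - y * y * c^*| ^+ 2.
Proof.
move=> /conj_Creal ar /conj_Creal br h; rewrite !normCK.
rewrite !(rmorphM, rmorphD, rmorphN, rmorphB) /= conjCK ar br.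
have -> : (a * b - c * c^*) * (x * x^* + y * y^*) ^+ 2 =
  (x * x^* * a + x * y^* * c + y * x^* * c^* + y * y^* * b) *
  (y^* * y * a - y^* * x * c - x^* * y * c^* + x^* * x * b)
  - (x * y * (b - a) + x * x * c - y * y * c^*) *
  (x^* * y^* * (b - a) + x^* * x^* * c^* - y^* * y^* * c) by ring.
by rewrite h mul0r sub0r.
Qed.

Variable Phi : 'I_4 -> 'I_2 -> 'I_2 -> C.

(** The entries of Phi_i E Phi_i^*. *)
Definition conjugated (E : C * C * C) i (a a' : 'I_2) : C :=
  let: (al, be, z) := E in
  Phi i a 0 * al * (Phi i a' 0)^* + Phi i a 0 * z * (Phi i a' 1)^* +
  Phi i a 1 * z^* * (Phi i a' 0)^* + Phi i a 1 * be * (Phi i a' 1)^*.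

(* With y a common null direction of all the conjugated forms, the determinant
   of a hermitian D with y^* D y = 0 is - |y^* D y'|^2 / |y|^4, y' being
   orthogonal to y, and y^* D y' is linear in D. *)
Lemma conjugated_det_le : exists E : C * C * C, indefinite E /\
  forall k, 0 <= k -> (k = 0 \/ exists i,
     k <= `|det2 (Phi i)| - \sum_(j | j != i) `|det2 (Phi j)|) ->
  det2 (fun a a' => \sum_i conjugated E i a a') <=
  k ^+ 2 * (E.1.1 * E.1.2 - E.2 * E.2^*).
Proof.
pose v i (y : C * C) := (Phi i 0 0 * y.1 + Phi i 1 0 * y.2,
  Phi i 0 1 * y.1 + Phi i 1 1 * y.2).
(* Proportionality of [v 0 y] and [v 1 y] is a binary quadratic equation in y. A solution leaves
   only three directions in which E has to vanish. *)
have [y [y0 hy]] : exists y, y != (0, 0) /\ wedge (v 0 y) (v 1 y) = 0.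
  have [y [y0 hy]] := binary_quadratic_root
    (Phi 0 0 0 * Phi 1 0 1 - Phi 0 0 1 * Phi 1 0 0)
    (Phi 0 0 0 * Phi 1 1 1 + Phi 0 1 0 * Phi 1 0 1
     - Phi 0 0 1 * Phi 1 1 0 - Phi 0 1 1 * Phi 1 0 0)
    (Phi 0 1 0 * Phi 1 1 1 - Phi 0 1 1 * Phi 1 1 0).
  by exists y; split => //; rewrite -[RHS]hy /wedge /v /=; ring.
pose h i := ((v i y).1^*, (v i y).2^*).
have h01 : wedge (h 0) (h 1) = 0.
  by rewrite -[RHS](rmorph0 Num.conj) -hy /wedge /h /= rmorphB !rmorphM.
have [E [iE [E0 E1 E2 E3]]] := hform_null4 (h (inord 2)) (h (inord 3)) h01.
have Eh i : hform E (h i) = 0.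
  case: i => -[|[|[|[|//]]]] p.
  - by rewrite -[RHS]E0; congr (hform _ (h _)); apply/val_inj.
  - by rewrite -[RHS]E1; congr (hform _ (h _)); apply/val_inj.
  - by rewrite -[RHS]E2; congr (hform _ (h _)); apply/val_inj; rewrite /= inordK.
  - by rewrite -[RHS]E3; congr (hform _ (h _)); apply/val_inj; rewrite /= inordK.
exists E; split=> // k k0 hk; case: E iE Eh {E0 E1 E2 E3} => [[al be] z].
move=> [alr ber dE] Eh /=.
have [cal cbe] := (conj_Creal alr, conj_Creal ber).
set D := conjugated (al, be, z).
have DC i a a' : (D i a a')^* = D i a' a.
  rewrite /D /= !(rmorphM, rmorphD) /= !conjCK cal cbe; ring.
pose S a a' := \sum_i D i a a'.
have SC a a' : (S a a')^* = S a' a.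
  by rewrite rmorph_sum; apply: eq_bigr => i _; rewrite /= DC.
pose q (M : 'I_2 -> 'I_2 -> C) := y.1 * y.1^* * M 0 0 + y.1 * y.2^* * M 0 1 +
  y.2 * y.1^* * M 1 0 + y.2 * y.2^* * M 1 1.
pose w (M : 'I_2 -> 'I_2 -> C) := y.1 * y.2 * (M 1 1 - M 0 0) +
  y.1 * y.1 * M 0 1 - y.2 * y.2 * M 1 0.
have qD i : q (D i) = 0.
  rewrite -[RHS](Eh i) /q /D /h /v /=.
  rewrite !(rmorphM, rmorphD) /= ?conjCK; ring.
have qS : q S = 0.
  have -> : q S = \sum_i q (D i) by rewrite /q /S !mulr_sumr -!big_split.
  by rewrite big1.
have wS : w S = \sum_i w (D i).
  rewrite /w /S -sumrB !mulr_sumr -big_split -sumrB /=.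
  by apply: eq_bigr.
pose N := `|y.1| ^+ 2 + `|y.2| ^+ 2.
have N0 : 0 < N.
  rewrite lt0r addr_ge0 ?exprn_ge0 // andbT paddr_eq0 ?exprn_ge0 //.
  by rewrite !expf_eq0 /= !normr_eq0 -xpair_eqE -surjective_pairing.
have idet (M : 'I_2 -> 'I_2 -> C) : (forall a a', (M a a')^* = M a' a) ->
    q M = 0 -> det2 M * N ^+ 2 = - `|w M| ^+ 2.
  move=> MC qM; rewrite /det2 -(MC 0 1) (@herm_det_isotropic _ _ _ y.1 y.2).
  - by rewrite MC.
  - by apply/CrealP; rewrite MC.
  - by apply/CrealP; rewrite MC.
  - by rewrite MC.
pose g := sqrtC (z * z^* - al * be).
have g2 : g ^+ 2 = z * z^* - al * be by rewrite sqrtCK.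
have g0 : 0 <= g by rewrite sqrtC_ge0 subr_ge0 -subr_le0 ltW.
have wD i : `|w (D i)| = `|det2 (Phi i)| * (N * g).
  apply/eqP; rewrite -(@eqrXn2 _ 2) ?mulr_ge0 ?(ltW N0) //.
  have := idet (D i) (DC i) (qD i) => /(congr1 -%R); rewrite opprK => <-.
  have -> : det2 (D i) = `|det2 (Phi i)| ^+ 2 * (al * be - z * z^*).
    rewrite normCK /det2 /D /= !(rmorphM, rmorphD, rmorphN, rmorphB) /=; ring.
  by apply/eqP; rewrite !exprMn g2; ring.
rewrite -(@ler_pM2r _ (N ^+ 2)) ?exprn_gt0 // -/S (idet S SC qS).
have -> : k ^+ 2 * (al * be - z * z^*) * N ^+ 2 = - (k * (N * g)) ^+ 2.
  by rewrite !exprMn g2; ring.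
rewrite lerN2 ler_pXn2r ?nnegrE ?mulr_ge0 ?(ltW N0) //.
case: hk => [->|[i hi]]; first by rewrite mul0r normr_ge0.
apply: le_trans (ler_wpM2r _ hi) _; first by rewrite mulr_ge0 ?(ltW N0).
rewrite wS [in leRHS](bigD1 i) //= mulrBl -wD mulr_suml.
apply: (le_trans _ (lerB_normD _ _)); rewrite lerD2l lerN2.
apply: (le_trans (ler_norm_sum _ _ _)).
by apply: ler_sum => j _; rewrite wD.
Qed.

Lemma herm_mx2_diag (al be z : C) : al \is Num.real -> be \is Num.real ->
  exists (P : 'M[C]_2) (d : 'I_2 -> C), [/\ P \is unitarymx,
    forall l, d l \is Num.real,
    al * be - z * z^* = d 0 * d 1 &
    [/\ al = \sum_l d l * (P l 0)^* * P l 0, z = \sum_l d l * (P l 0)^* * P l 1,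
      z^* = \sum_l d l * (P l 1)^* * P l 0 &
      be = \sum_l d l * (P l 1)^* * P l 1]].
Proof.
move=> /conj_Creal alr /conj_Creal ber.
pose M : 'M[C]_2 := \matrix_(b, b') (if b == 0 then if b' == 0 then al else z
   else if b' == 0 then z^* else be).
have Mh : M \is hermsymmx.
  apply/is_hermitianmxP; rewrite expr0 scale1r.
  apply/matrixP => i j; rewrite !mxE.
  by do 2!case: ifP => _; rewrite /= ?conjCK ?alr ?ber.
have /hermitian_normalmx/orthomx_spectralP ME := Mh.
have Pu := spectral_unitarymx M.
have dr := hermitian_spectral_diag_real Mh.
move: ME; rewrite (invmx_unitary Pu).
set P := spectralmx M in Pu *; set d := spectral_diag M in dr * => ME.
have Mbb b b' : M b b' = \sum_l d 0 l * (P l b)^* * P l b'.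
  rewrite ME mxE; apply: eq_bigr => l _.
  by rewrite mul_mx_diag !mxE; ring.
exists P, (d 0); split => //.
- by move=> l; move/mxOverP: dr; apply.
- have -> : al * be - z * z^* = \det M by rewrite det_mx2 /det2 !mxE.
  rewrite ME !det_mulmx det_diag mulrC mulrA -det_mulmx (unitarymxP Pu) det1 mul1r.
  by rewrite big_ord_recl big_ord1; congr (d 0 _ * d 0 _); apply/val_inj.
- by rewrite -!Mbb !mxE.
Qed.

(** The unnormalized state of A after the outcome [l] of a measurement of B in the basis given by
    the rows of [P]. *)
Definition measured (P : 'M[C]_2) (l a a' : 'I_2) : C :=
  \sum_i (\sum_b Phi i a b * (P l b)^*) * (\sum_b Phi i a' b * (P l b)^*)^*.

(** In the eigenbasis of E, with eigenvalues d0 d1 < 0, the conjugated matrices sum to d0 R_0 + d1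
    R_1. Its determinant is d0^2 a^2 + d1^2 b^2 + d0 d1 m, where a^2 and b^2 are the determinants of
    R_0 and R_1 and m = det(R_0 + R_1) - a^2 - b^2. It is at most k^2 d0 d1. Adding (d0 a + d1 b)^2
    >= 0 and dividing by the negative d0 d1 gives m >= 2 a b + k^2. *)
Theorem measurement_basis k : 0 <= k ->
  (k = 0 \/ exists i,
     k <= `|det2 (Phi i)| - \sum_(j | j != i) `|det2 (Phi j)|) ->
  exists P : 'M[C]_2, P \is unitarymx /\
    (sqrtC (det2 (measured P 0)) + sqrtC (det2 (measured P 1))) ^+ 2 + k ^+ 2
    <= det2 (fun a a' => measured P 0 a a' + measured P 1 a a').
Proof.
move=> k0 hk; have [[[al be] z] [iE hE]] := conjugated_det_le.
have /= {hE hk}hE := hE k k0 hk; case: iE => alr ber dE.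
have [P [d [Pu dr dd [alE zE zcE beE]]]] := herm_mx2_diag z alr ber.
rewrite dd in hE dE; exists P; split=> //.
have RE a a' : \sum_i conjugated (al, be, z) i a a' =
    d 0 * measured P 0 a a' + d 1 * measured P 1 a a'.
  rewrite /measured !mulr_sumr -big_split; apply: eq_bigr => i _ /=.
  rewrite zcE alE zE beE !sum_qubit !(rmorphM, rmorphD) /= !conjCK; ring.
have p_ge0 l : 0 <= det2 (measured P l) by apply: gram_det_ge0.
have mC l a a' : (measured P l a a')^* = measured P l a' a.
  rewrite rmorph_sum; apply: eq_bigr => i _.
  by rewrite rmorphM /= conjCK mulrC.
move: hE; rewrite /det2 !RE.
have := p_ge0 0; have := p_ge0 1.
move: (dr 0) (dr 1) dE => {}dr0 dr1.
set d0 := d 0 in dr0 *; set d1 := d 1 in dr1 * => dE p1 p0 hE.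
set a := sqrtC (det2 (measured P 0)); set b := sqrtC (det2 (measured P 1)).
have a0 : 0 <= a by rewrite sqrtC_ge0.
have b0 : 0 <= b by rewrite sqrtC_ge0.
have a2 : a ^+ 2 = det2 (measured P 0) by rewrite sqrtCK.
have b2 : b ^+ 2 = det2 (measured P 1) by rewrite sqrtCK.
have sq : 0 <= (d0 * a + d1 * b) ^+ 2.
  rewrite real_exprn_even_ge0 //.
  by apply: realD; apply: realM => //; apply: ger0_real.
rewrite -subr_ge0 -(@nmulr_rle0 _ (d0 * d1)) //.
apply: le_trans (_ : _ <= - (d0 * a + d1 * b) ^+ 2) _; last by rewrite oppr_le0.
rewrite -subr_ge0; move: hE; rewrite -subr_ge0.
set T := (measured P 0 0 0 + measured P 1 0 0) * _ - _.
have -> : - (d0 * a + d1 * b) ^+ 2 - d0 * d1 * (T - ((a + b) ^+ 2 + k ^+ 2)) =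
    - (d0 ^+ 2 * a ^+ 2 + d1 ^+ 2 * b ^+ 2)
    - d0 * d1 * (T - a ^+ 2 - b ^+ 2 - k ^+ 2) by ring.
rewrite a2 b2 /T /det2; set X := (X in 0 <= X); move=> X0.
by set Y := (Y in 0 <= Y); have -> : Y = X by rewrite /X /Y; ring.
Qed.

End Measurement.

(** * Minkowski's inequality *)

Lemma Minkowski2 (F : numFieldType) (I : eqType) (r : seq I) (x y : I -> F) a b :
  (forall i, 0 <= x i) -> (forall i, 0 <= y i) -> 0 <= a -> 0 <= b ->
  \sum_(i <- r) x i ^+ 2 <= a ^+ 2 -> \sum_(i <- r) y i ^+ 2 <= b ^+ 2 ->
  \sum_(i <- r) (x i + y i) ^+ 2 <= (a + b) ^+ 2.
Proof.
move=> x0 y0 a0 b0 xa yb.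
have zero (q : seq I) (u v : I -> F) : (forall i, 0 <= u i) ->
    \sum_(i <- q) u i ^+ 2 <= 0 -> \sum_(i <- q) u i * v i = 0.
  move=> u0 us; have {us} : \sum_(i <- q) u i ^+ 2 == 0.
    by rewrite eq_le us sumr_ge0 // => i _; rewrite exprn_ge0.
  rewrite psumr_eq0 => [|i _]; last by rewrite exprn_ge0.
  elim: q => [|i q IH] /=; first by rewrite big_nil.
  move=> /andP[]; rewrite sqrf_eq0 => /eqP ui /IH.
  by rewrite big_cons ui mul0r add0r.
(* Cauchy-Schwarz, by summing (b x_i - a y_i)^2 >= 0; if a or b is 0, the products vanish. *)
have cs : \sum_(i <- r) x i * y i <= a * b.
  have [a_0|a_0] := eqVneq a 0.
    by rewrite zero ?a_0 ?mul0r //; move: xa; rewrite a_0 expr0n.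
  have [b_0|b_0] := eqVneq b 0.
    rewrite (eq_bigr (fun i => y i * x i)) => [|i _]; last exact: mulrC.
    by rewrite zero ?b_0 ?mulr0 //; move: yb; rewrite b_0 expr0n.
  have ab : 0 < a * b by rewrite mulr_gt0 // lt0r ?a_0 ?b_0.
  have ab2 : 0 < 2 * (a * b) by rewrite pmulr_rgt0 ?ltr0n.
  rewrite -(ler_pM2l ab2) mulr_sumr.
  apply: (@le_trans _ _ (\sum_(i <- r) (b ^+ 2 * x i ^+ 2 + a ^+ 2 * y i ^+ 2))).
    apply: ler_sum => i _; rewrite -subr_ge0.
    have -> : b ^+ 2 * x i ^+ 2 + a ^+ 2 * y i ^+ 2 - 2 * (a * b) * (x i * y i) =
      (b * x i - a * y i) ^+ 2 by ring.
    by rewrite real_exprn_even_ge0 // realB // ger0_real // mulr_ge0.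
  rewrite big_split -!mulr_sumr /=.
  have -> : 2 * (a * b) * (a * b) = b ^+ 2 * a ^+ 2 + a ^+ 2 * b ^+ 2 by ring.
  by apply: lerD; rewrite ler_wpM2l ?exprn_ge0.
rewrite (eq_bigr (fun i => x i ^+ 2 + x i * y i *+ 2 + y i ^+ 2)) => [|i _].
  by rewrite !big_split /= -mulr2n sqrrD !lerD // ler_wMn2r.
exact: sqrrD.
Qed.

Lemma Minkowski_sum (F : numFieldType) (I : eqType) (K : Type) (r : seq I) (s : seq K)
    (x : K -> I -> F) (a : K -> F) :
  (forall k i, 0 <= x k i) -> (forall k, 0 <= a k) ->
  (forall k, \sum_(i <- r) x k i ^+ 2 <= a k ^+ 2) ->
  \sum_(i <- r) (\sum_(k <- s) x k i) ^+ 2 <= (\sum_(k <- s) a k) ^+ 2.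
Proof.
move=> x0 a0 xa; elim: s => [|k s IH].
  by rewrite big_nil expr0n big1 // => i _; rewrite big_nil expr0n.
rewrite big_cons.
rewrite (eq_bigr (fun i => (x k i + \sum_(k <- s) x k i) ^+ 2)) => [|i _].
  by apply: Minkowski2 => // [i|]; apply: sumr_ge0.
by rewrite big_cons.
Qed.

(** * The spin flip and a good measurement basis for two qubits *)

Section TwoQubits.
Variable C : numClosedFieldType.
Local Notation m := #|{: qubit * qubit}|.
Implicit Types (S : 'M[C]_m) (a b : qubit).

(* The concurrence of a pure state x is |x^T spin_flip x|. *)
Definition spin_flip : 'M[C]_m := \matrix_(r, c)
  (let: (a, b) := enum_val r in let: (a', b') := enum_val c in
   if (a != a') && (b != b') then (if a == b then 1 else -1) else 0).

Lemma tr_spin_flip : spin_flip^T = spin_flip.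
Proof.
apply/matrixP => r c; rewrite !mxE.
case: (enum_val r) => a b; case: (enum_val c) => a' b'.
rewrite (eq_sym a' a) (eq_sym b' b).
move: a b a' b'.
by do 4!(case=> -[|[|//]] ?).
Qed.

Definition amp2 (x : 'cV[C]_m) a b : C := x (enum_rank (a, b)) 0.

Lemma sum_two_qubits (V : nmodType) (F : 'I_m -> V) :
  \sum_r F r = F (enum_rank (0, 0)) + F (enum_rank (0, 1)) +
    F (enum_rank (1, 0)) + F (enum_rank (1, 1)).
Proof.
rewrite (reindex (@enum_rank {: qubit * qubit})) /=; last first.
  by apply: onW_bij; apply: enum_rank_bij.
transitivity (\sum_(a : 'I_2) \sum_(b : 'I_2) F (enum_rank (a, b))).
  by rewrite pair_bigA; apply: eq_bigr => -[].
by rewrite !sum_qubit addrA.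
Qed.

Lemma bil_spin_flip (x : 'cV[C]_m) : bil spin_flip x x = 2 * det2 (amp2 x).
Proof.
rewrite /bil mxE sum_two_qubits !mxE !sum_two_qubits !mxE !enum_rankK /=.
rewrite /det2 /amp2; ring.
Qed.

(** The same state as [measured], read off the density matrix and so independent of any
    decomposition. *)
Definition partial_meas (P : 'M[C]_2) S l a a' : C :=
  \sum_(b : qubit) \sum_(b' : qubit)
    S (enum_rank (a, b)) (enum_rank (a', b')) * ((P l b)^* * P l b').

(** The entry [d 0 i] is 2 |det Phi_i|, so k is half of Wootters' value: 0 if the phases can cancel,
    and otherwise half of the largest entry minus the others. *)
Lemma frame_measurement n (G : 'M[C]_(m, n)) d : n = 4 ->
  diag_frame spin_flip G d ->
  exists k (P : 'M[C]_2), [/\ 0 <= k, roof_le spin_flip (G *m G^t*) (2 * k),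
    P \is unitarymx &
    let R := partial_meas P (G *m G^t*) in
    (sqrtC (det2 (R 0)) + sqrtC (det2 (R 1))) ^+ 2 + k ^+ 2 <=
    det2 (fun a a' => R 0 a a' + R 1 a a')].
Proof.
move=> n4; subst n => Gd; have d0 := Gd.1.
pose Phi i (a b : 'I_2) := G (enum_rank (a, b)) i.
have dPhi i : `|det2 (Phi i)| = d 0 i / 2.
  have := frame_bil i i Gd; rewrite eqxx mulr1n bil_spin_flip.
  have -> : det2 (amp2 (col i G)) = det2 (Phi i) by rewrite /det2 /amp2 !mxE.
  move=> e; have -> : det2 (Phi i) = d 0 i / 2 by rewrite -e; field.
  by rewrite ger0_norm // divr_ge0 // ler0n.
have RE P l a a' : measured Phi P l a a' = partial_meas P (G *m G^t*) l a a'.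
  rewrite /measured /partial_meas.
  under eq_bigr do rewrite rmorph_sum big_distrlr /=.
  rewrite exchange_big /=; apply: eq_bigr => b _.
  rewrite exchange_big /=; apply: eq_bigr => b' _.
  rewrite mxE mulr_suml; apply: eq_bigr => i _.
  by rewrite !mxE rmorphM /= conjCK /Phi; ring.
have [k [k0 hk rk]] : exists k, [/\ 0 <= k,
    k = 0 \/ exists i,
      k <= `|det2 (Phi i)| - \sum_(j | j != i) `|det2 (Phi j)| &
    roof_le spin_flip (G *m G^t*) (2 * k)].
  have [/existsP[i hi]|] :=
      boolP [exists i, \sum_(j | j != i) d 0 j < d 0 i]; last first.
    rewrite negb_exists => /forallP hd.
    have [i|e [e1 e0]] := cancelling_phases d0.
      by rewrite real_leNgt ?ger0_real // ?sumr_ge0.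
    exists 0; split; [by []|by left|].
    by have := frame_roof_le tr_spin_flip Gd e1; rewrite e0 normr0 mulr0.
  have [e [e1 e2]] := signed_phases i Gd.
  exists ((d 0 i - \sum_(j | j != i) d 0 j) / 2); split.
  - by rewrite divr_ge0 ?ler0n // subr_ge0 ltW.
  - right; exists i; rewrite dPhi mulrBl lerD2l lerN2 mulr_suml.
    by apply: ler_sum => j _; rewrite dPhi.
  - rewrite mulrC divfK ?pnatr_eq0 //.
    rewrite -(ger0_norm (_ : 0 <= d 0 i - _)) ?subr_ge0 ?ltW //.
    rewrite -(sum_signs _ e2).
    exact: (frame_roof_le tr_spin_flip Gd e1).
have [P [Pu hP]] := measurement_basis k0 hk.
exists k, P; split=> //=.
by move: hP; rewrite /det2 !RE.
Qed.

(** The list [s] may have any length, but a square factor F of [S] has four columns, which give a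
    frame of exactly four matrices. *)
Lemma two_qubit_measurement s :
  let S := ketsum s in
  exists k (P : 'M[C]_2), [/\ 0 <= k, roof_le spin_flip S (2 * k),
    P \is unitarymx &
    let R := partial_meas P S in
    (sqrtC (det2 (R 0)) + sqrtC (det2 (R 1))) ^+ 2 + k ^+ 2 <=
    det2 (fun a a' => R 0 a a' + R 1 a a')].
Proof.
move=> S.
have [F SE] : exists F : 'M[C]_m, S = F *m F^t*.
  apply: psd_factor.
    apply/is_hermitianmxP; rewrite expr0 scale1r /S -ketmxE.
    by rewrite trmx_mul map_mxM trmxCK.
  move=> v; rewrite /S -ketmxE.
  have -> : v^t* *m (ketmx s *m (ketmx s)^t*) *m v =
      ((ketmx s)^t* *m v)^t* *m ((ketmx s)^t* *m v).
    by rewrite trmx_mul map_mxM trmxCK !mulmxA.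
  exact: normCv_ge0.
pose L := [seq col i F | i <- enum 'I_m].
have LS : ketsum L = S.
  by rewrite /ketsum big_map big_enum /= SE mulmx_ketsum.
have [G [d [Gd GE _]]] := diag_frame_exists tr_spin_flip L.
have sz : size L = 4%N.
  by rewrite size_map size_enum_ord card_prod card_ord.
by have := frame_measurement sz Gd; rewrite GE LS.
Qed.

End TwoQubits.

(** * Monogamy of the concurrence *)

Section Bits.
Variables (n : nat) (j : 'I_n).
Implicit Types (y z : qubits n) (b : qubit).

Lemma set_bit_get y b : set_bit j y b j = b.
Proof. by rewrite ffunE eqxx. Qed.

Lemma set_bit_other k y b : k != j -> set_bit j y b k = y k.
Proof. by move=> kj; rewrite ffunE (negPf kj). Qed.

Lemma set_bit_set y b b' : set_bit j (set_bit j y b) b' = set_bit j y b'.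
Proof. by apply/ffunP => k; rewrite !ffunE; case: eqP. Qed.

Lemma set_bit_id y b : y j = b -> set_bit j y b = y.
Proof. by move=> <-; apply/ffunP => k; rewrite ffunE; case: eqP => [->|]. Qed.

Lemma set_bitC k y b b' : k != j ->
  set_bit j (set_bit k y b') b = set_bit k (set_bit j y b) b'.
Proof.
move=> kj; apply/ffunP => l; rewrite !ffunE.
by case: eqP => // ->; rewrite eq_sym (negPf kj).
Qed.

Variable V : nmodType.
Implicit Types (Q : pred (qubits n)) (F : qubits n -> V).

(** An assignment of the bits other than [j] can be represented with either value at [j]; [Q]
    constrains only those other bits. *)
Lemma sum_fixed_bit Q F b b' : (forall y c, Q (set_bit j y c) = Q y) ->
  \sum_(y : qubits n | Q y && (y j == b)) F y =
  \sum_(z : qubits n | Q z && (z j == b')) F (set_bit j z b).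
Proof.
move=> QE.
rewrite (reindex_onto (fun z => set_bit j z b) (fun y => set_bit j y b')) /=.
  apply: eq_bigl => z; rewrite QE set_bit_get eqxx andbT set_bit_set.
  congr (_ && _); apply/eqP/eqP => [<-|]; first exact: set_bit_get.
  exact: set_bit_id.
by move=> y /andP[_ /eqP yb]; rewrite set_bit_set set_bit_id.
Qed.

Lemma sum_split_bit Q F b' : (forall y c, Q (set_bit j y c) = Q y) ->
  \sum_(y : qubits n | Q y) F y =
  \sum_(z : qubits n | Q z && (z j == b')) \sum_b F (set_bit j z b).
Proof.
move=> QE; rewrite (partition_big (fun y : qubits n => y j) predT) //= exchange_big /=.
by apply: eq_bigr => b _; apply: sum_fixed_bit.
Qed.

End Bits.

Section Monogamy.
Variables (C : numClosedFieldType) (n : nat).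
Local Notation m := #|{: qubit * qubit}|.
Implicit Types (psi : qubit -> qubits n -> C) (a b : qubit) (j : 'I_n).

Definition rhoA psi a a' : C := \sum_y psi a y * (psi a' y)^*.

Definition reduced j psi : 'M[C]_m := \matrix_(r, c)
  (let: (a, b) := enum_val r in let: (a', b') := enum_val c in
   \sum_(y : qubits n | y j == b) psi a y * (psi a' (set_bit j y b'))^*).

Lemma reducedE j psi a b a' b' :
  reduced j psi (enum_rank (a, b)) (enum_rank (a', b')) =
  \sum_(z : qubits n | z j == 0)
     psi a (set_bit j z b) * (psi a' (set_bit j z b'))^*.
Proof.
rewrite mxE !enum_rankK.
rewrite (@sum_fixed_bit _ j _ predT _ b 0) //=.
by apply: eq_bigr => z _; rewrite set_bit_set.
Qed.

Lemma mx_two_qubitsP (S T : 'M[C]_m) :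
  (forall a b a' b', S (enum_rank (a, b)) (enum_rank (a', b')) =
     T (enum_rank (a, b)) (enum_rank (a', b'))) -> S = T.
Proof.
move=> h; apply/matrixP => r c.
rewrite -(enum_valK r) -(enum_valK c).
by case: (enum_val r) => a b; case: (enum_val c) => a' b'; apply: h.
Qed.

(** Tracing out the other qubits leaves one unnormalized ket for each assignment of their bits. *)
Lemma reduced_ketsum j psi : exists s, reduced j psi = ketsum s.
Proof.
exists [seq \col_r psi (enum_val r).1 (set_bit j z (enum_val r).2)
  | z : qubits n <- enum (fun z : qubits n => z j == 0)].
apply: mx_two_qubitsP => a b a' b'.
rewrite reducedE /ketsum big_map big_enum /= summxE; apply: eq_bigr => z _.
by rewrite mxE big_ord1 !mxE !enum_rankK.
Qed.

(* The unnormalized state after the outcome [l] of the measurement of qubit [j]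
   in the basis given by the rows of [P]; qubit [j] is reset to |l>. *)
Definition collapse (P : 'M[C]_2) j psi (l : qubit) a (y : qubits n) : C :=
  if y j == l then \sum_(b : qubit) (P l b)^* * psi a (set_bit j y b) else 0.

(** What the measurement of qubit [j] does to A depends only on the reduced matrix on A and [j].
    This gives access to the two-qubit bound. *)
Lemma rhoA_collapse P j psi l a a' :
  rhoA (collapse P j psi l) a a' = partial_meas P (reduced j psi) l a a'.
Proof.
rewrite /partial_meas.
under eq_bigr do under eq_bigr do rewrite reducedE mulr_suml.
under eq_bigr do rewrite exchange_big /=.
rewrite exchange_big /= /rhoA.
rewrite (bigID (fun y : qubits n => y j == l)) /= [X in _ + X]big1 ?addr0;
  last by move=> y yl; rewrite /collapse (negPf yl) mul0r.
rewrite (@sum_fixed_bit _ j _ predT _ l 0) //=; apply: eq_bigr => z _.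
rewrite /collapse set_bit_get eqxx rmorph_sum big_distrlr /=.
apply: eq_bigr => b _; apply: eq_bigr => b' _.
by rewrite !set_bit_set rmorphM /= conjCK; ring.
Qed.

Lemma unitary_cols (P : 'M[C]_2) b b' : P \is unitarymx ->
  \sum_l (P l b)^* * P l b' = (b == b')%:R.
Proof.
move=> Pu; have /matrixP/(_ b b') : P^t* *m P = 1%:M.
  by apply/mulmx1C/unitarymxP.
by rewrite !mxE => <-; apply: eq_bigr => l _; rewrite !mxE.
Qed.

Lemma sum_unitary (P : 'M[C]_2) (F G : qubit -> C) : P \is unitarymx ->
  \sum_l (\sum_b (P l b)^* * F b) * (\sum_b (P l b)^* * G b)^* =
  \sum_b F b * (G b)^*.
Proof.
move=> Pu; under eq_bigr do rewrite rmorph_sum big_distrlr /=.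
rewrite exchange_big /=; apply: eq_bigr => b _.
rewrite exchange_big /= (bigD1 b) //= [X in _ + X]big1 ?addr0.
  rewrite (eq_bigr (fun l => (P l b)^* * P l b * (F b * (G b)^*))).
    by rewrite -mulr_suml unitary_cols // eqxx mul1r.
  by move=> l _; rewrite rmorphM /= conjCK; ring.
move=> b' b'b.
rewrite (eq_bigr (fun l => (P l b)^* * P l b' * (F b * (G b')^*))).
  by rewrite -mulr_suml unitary_cols // eq_sym (negPf b'b) mul0r.
by move=> l _; rewrite rmorphM /= conjCK; ring.
Qed.

(** A measurement whose outcome is forgotten does not change the partial trace over [j]. The
    assignments y and y' may differ elsewhere, as is needed when another qubit is kept. *)
Lemma sum_collapse (P : 'M[C]_2) j psi (y y' : qubits n) a a' :
  P \is unitarymx ->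
  \sum_(b : qubit) \sum_(l : qubit) collapse P j psi l a (set_bit j y b) *
    (collapse P j psi l a' (set_bit j y' b))^* =
  \sum_(b : qubit) psi a (set_bit j y b) * (psi a' (set_bit j y' b))^*.
Proof.
move=> Pu; rewrite exchange_big /=.
rewrite -(sum_unitary (fun b => psi a (set_bit j y b))
  (fun b => psi a' (set_bit j y' b)) Pu).
apply: eq_bigr => l _; rewrite (bigD1 l) //= [X in _ + X]big1 ?addr0.
  rewrite /collapse !set_bit_get eqxx.
  by congr (_ * _^*); apply: eq_bigr => b _; rewrite set_bit_set.
by move=> b bl; rewrite /collapse set_bit_get (negPf bl) mul0r.
Qed.

Lemma rhoA_collapse_sum P j psi a a' : P \is unitarymx ->
  rhoA (collapse P j psi 0) a a' + rhoA (collapse P j psi 1) a a' =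
  rhoA psi a a'.
Proof.
move=> Pu; rewrite /rhoA -[LHS](sum_qubit (fun l => \sum_y
  collapse P j psi l a y * (collapse P j psi l a' y)^*)).
rewrite exchange_big /= !(@sum_split_bit _ j _ predT _ 0) //=.
apply: eq_bigr => z _; exact: sum_collapse.
Qed.

Lemma reduced_collapse_sum P j k psi : P \is unitarymx -> k != j ->
  reduced k (collapse P j psi 0) + reduced k (collapse P j psi 1) =
  reduced k psi.
Proof.
move=> Pu kj; apply: mx_two_qubitsP => a b a' b'.
rewrite mxE !reducedE -[LHS](sum_qubit (fun l => \sum_(z : qubits n | z k == 0)
  collapse P j psi l a (set_bit k z b) *
  (collapse P j psi l a' (set_bit k z b'))^*)).
rewrite exchange_big /=.
have QE (y : qubits n) (c : qubit) : (set_bit j y c k == 0) = (y k == 0).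
  by rewrite set_bit_other.
rewrite !(@sum_split_bit _ j _ (fun z : qubits n => z k == 0) _ 0) //=.
apply: eq_bigr => z _.
have swap (e c : qubit) : set_bit k (set_bit j z c) e = set_bit j (set_bit k z e) c.
  by rewrite [RHS]set_bitC.
under eq_bigr do under eq_bigr do rewrite !swap.
under [RHS]eq_bigr do rewrite !swap.
exact: sum_collapse.
Qed.

Lemma det2_rhoA_ge0 psi : 0 <= det2 (rhoA psi).
Proof. exact: gram_det_ge0 (fun y a => psi a y). Qed.

(** Induction on [J], over unnormalized states. The first qubit is measured in the basis of
    [two_qubit_measurement] and gets the bound 2 k. The others get the sum of their bounds in the
    two collapsed states, and Minkowski's inequality bounds the sum of squares by (2 p_0 + 2 p_1)^2
    with p_l the square root of det R_l. The gain k^2 of the measurement absorbs the first qubit. *)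
Theorem concurrence_monogamy (J : seq 'I_n) psi : uniq J ->
  exists c : 'I_n -> C, [/\ forall j, 0 <= c j,
    forall j, j \in J -> roof_le (spin_flip C) (reduced j psi) (c j) &
    \sum_(j <- J) c j ^+ 2 <= 4 * det2 (rhoA psi)].
Proof.
elim: J psi => [|j J IH] psi.
  exists (fun=> 0); split=> //.
  by rewrite big_nil mulr_ge0 ?ler0n // det2_rhoA_ge0.
move=> /= /andP[jJ uJ].
have [s sE] := reduced_ketsum j psi.
have [k [P [k0 rk Pu]]] := two_qubit_measurement s.
rewrite /= -sE in rk *.
have RE l a a' : partial_meas P (reduced j psi) l a a' =
  rhoA (collapse P j psi l) a a' by rewrite rhoA_collapse.
have -> : det2 (fun a a' => partial_meas P (reduced j psi) 0 a a' +
    partial_meas P (reduced j psi) 1 a a') = det2 (rhoA psi).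
  by rewrite /det2 !RE !rhoA_collapse_sum.
have -> : det2 (partial_meas P (reduced j psi) 0) =
  det2 (rhoA (collapse P j psi 0)) by rewrite /det2 !RE.
have -> : det2 (partial_meas P (reduced j psi) 1) =
  det2 (rhoA (collapse P j psi 1)) by rewrite /det2 !RE.
move=> hP.
have [c0 [c0_ge0 c0r c0s]] := IH (collapse P j psi 0) uJ.
have [c1 [c1_ge0 c1r c1s]] := IH (collapse P j psi 1) uJ.
exists (fun i => if i == j then 2 * k else c0 i + c1 i); split.
- by move=> i; case: ifP => _; rewrite ?addr_ge0 ?mulr_ge0 ?ler0n.
- move=> i; rewrite inE; case: eqP => [->|/eqP ij] //= iJ.
  by rewrite -(reduced_collapse_sum psi Pu ij); apply: roof_leD; auto.
rewrite big_cons eqxx.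
rewrite (eq_big_seq (fun i => (c0 i + c1 i) ^+ 2)) => [|i iJ]; last first.
  by case: eqP => // ij; move: jJ; rewrite -ij iJ.
pose p l := sqrtC (det2 (rhoA (collapse P j psi l))).
have p0 l : 0 <= p l by rewrite sqrtC_ge0 det2_rhoA_ge0.
have p4 l : 4 * det2 (rhoA (collapse P j psi l)) = (2 * p l) ^+ 2.
  by rewrite exprMn sqrtCK; congr (_ * _); rewrite expr2 -natrM.
have pp l : 0 <= 2 * p l by rewrite mulr_ge0 ?ler0n.
rewrite !p4 in c0s c1s.
have h := Minkowski2 c0_ge0 c1_ge0 (pp 0) (pp 1) c0s c1s.
apply: (@le_trans _ _ ((2 * k) ^+ 2 + (2 * p 0 + 2 * p 1) ^+ 2)).
  by rewrite lerD2l.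
have -> : (2 * k) ^+ 2 + (2 * p 0 + 2 * p 1) ^+ 2 =
  4 * ((p 0 + p 1) ^+ 2 + k ^+ 2) by ring.
by rewrite ler_wpM2l ?ler0n.
Qed.

End Monogamy.

Local Open Scope complex_scope.

(** * The G-concurrence *)

(** For use at the size [#|qubit|], with indices given by [enum_rank]. *)
Lemma det_dim2 (C : comNzRingType) n (A : 'M[C]_n) (i j : 'I_n) :
  n = 2 -> i != j -> \det A = A i i * A j j - A i j * A j i.
Proof.
move=> n2; subst n; rewrite det_mx2 /det2.
case: i j => -[|[|//]] pi [[|[|//]]] pj //= _.
  by congr (A _ _ * A _ _ - A _ _ * A _ _); apply/val_inj.
rewrite mulrC [X in _ - X]mulrC.
by congr (A _ _ * A _ _ - A _ _ * A _ _); apply/val_inj.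
Qed.

Section Pure.
Variables (R : realType) (w : R).

Lemma trace_mxpowR n (A : 'M[R[i]]_n) : n = 2 -> A \is hermsymmx ->
  exists d0 d1 : R, [/\ complex.Re (\tr (mxpowR A w)) = d0 `^ w + d1 `^ w,
    \tr A = (d0 + d1)%:C & \det A = (d0 * d1)%:C].
Proof.
move=> n2 Ah; subst n.
have Ar := hermitian_spectral_diag_real Ah.
have /hermitian_normalmx/orthomx_spectralP AE := Ah.
have Pu := spectral_unit A.
move: AE Ar; rewrite /mxpowR.
set P := spectralmx A in Pu *; set d := spectral_diag A => AE Ar.
have dE i : d 0 i = (complex.Re (d 0 i))%:C.
  by move/mxOverP: Ar => /(_ 0 i)/complex_realP[r ->].
have sum2 (F : 'I_2 -> R[i]) : \sum_i F i = F 0 + F 1 by apply: sum_qubit.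
exists (complex.Re (d 0 0)), (complex.Re (d 0 1)); split.
- rewrite mxtrace_mulC mulmxA mulmxV // mul1mx /mxtrace sum2 !mxE.
  by rewrite !eqxx !mulr1n.
- rewrite AE mxtrace_mulC mulmxA mulmxV // mul1mx /mxtrace sum2 !mxE.
  by rewrite !eqxx !mulr1n rmorphD /= -!dE.
- rewrite AE !det_mulmx mulrAC -det_mulmx mulVmx // det1 mul1r det_diag.
  rewrite rmorphM /= -!dE big_ord_recl big_ord1.
  by congr (d _ _ * d _ _); apply/val_inj.
Qed.

Definition amps (Y : finType) (phi : 'cV[R[i]]_#|{: qubit * Y}|)
    (a : qubit) (y : Y) : R[i] := phi (enum_rank (a, y)) 0.

(** The determinant of the reduced state of A. *)
Definition gram_det (Y : finType) (phi : 'cV[R[i]]_#|{: qubit * Y}|) : R[i] :=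
  det2 (fun a a' => \sum_y amps phi a y * (amps phi a' y)^*).

Lemma sum_prod_rank (Y : finType) (V : nmodType) (F : 'I_#|{: qubit * Y}| -> V) :
  \sum_r F r = \sum_(a : qubit) \sum_y F (enum_rank (a, y)).
Proof.
rewrite (reindex (@enum_rank {: qubit * Y})) /=; last first.
  by apply: onW_bij; apply: enum_rank_bij.
by rewrite pair_bigA; apply: eq_bigr => -[].
Qed.

(** The eigenvalues of rho_A sum to 1, so x = 4 det rho_A is at most 1. They are the roots of the
    quadratic that also has the root [small_ev x], and [powdef] is symmetric in v and 1 - v. *)
Lemma Gconc_pureE (Y : finType) (phi : 'cV[R[i]]_#|{: qubit * Y}|) :
  is_unit_vector phi -> exists x : R, [/\ 0 <= x <= 1,
    4 * gram_det phi = x%:C & Gconc_pure w phi = Gsq w x].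
Proof.
move=> phi1; rewrite /Gconc_pure; set A := ptrace2 (ketbra phi).
have n2 : #|qubit| = 2 by rewrite card_ord.
have AE i j : A i j = \sum_y amps phi (enum_val i) y * (amps phi (enum_val j) y)^*.
  by rewrite mxE; apply: eq_bigr => y _; rewrite mxE big_ord1 !mxE.
have Ah : A \is hermsymmx.
  apply/is_hermitianmxP; rewrite expr0 scale1r; apply/matrixP => i j.
  rewrite !mxE rmorph_sum; apply: eq_bigr => y _.
  by rewrite !mxE !big_ord1 !mxE rmorphM /= conjCK mulrC.
have [d0 [d1 [-> trA detA]]] := trace_mxpowR n2 Ah.
have detE : gram_det phi = (d0 * d1)%:C.
  have r01 : enum_rank (0 : qubit) != enum_rank (1 : qubit).
    by rewrite (inj_eq enum_rank_inj).
  by rewrite -detA (det_dim2 A n2 r01) !AE !enum_rankK.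
have dd : d0 + d1 = 1.
  have : \tr A = 1.
    rewrite -[RHS]phi1 /mxtrace (reindex (@enum_rank qubit)) /=; last first.
      by apply: onW_bij; apply: enum_rank_bij.
    rewrite mxE sum_prod_rank; apply: eq_bigr => a _.
    rewrite AE enum_rankK; apply: eq_bigr => y _.
    by rewrite !mxE mulrC.
  by rewrite trA => /complexI.
have g0 : 0 <= d0 * d1.
  have := gram_det_ge0 (fun y a => amps phi a y).
  by rewrite -/(gram_det phi) detE lecR.
have d1E : d1 = 1 - d0 by lra.
have x1 : 4 * (d0 * d1) <= 1 by have := sqr_ge0 (2 * d0 - 1); rewrite d1E; lra.
exists (4 * (d0 * d1)); split.
- by apply/andP; split; rewrite // mulr_ge0.
- by rewrite detE [RHS]rmorphM rmorph_nat.
- rewrite Gsq.unlock /powdef; set v := small_ev _.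
  have vE : 4 * (v * (1 - v)) = 4 * (d0 * d1) by apply: small_evE.
  have : (d0 - v) * (d0 - (1 - v)) = 0 by rewrite d1E in vE; lra.
  move/eqP; rewrite mulf_eq0 => /orP[]; rewrite subr_eq0 => /eqP d0v.
    by rewrite d1E d0v.
  have -> : d1 = v by lra.
  by rewrite d0v [(1 - v) `^ w + _]addrC.
Qed.

End Pure.

Lemma ge0_ReE (R : realType) (z : R[i]) : 0 <= z -> z = (complex.Re z)%:C.
Proof. by move=> /ger0_real/complex_realP[r ->]. Qed.

(** * Upper bounds from mixtures *)

Section Mixtures.
Variables (R : realType) (w : R).

Definition mixture_le (Y : finType) (S : 'M[R[i]]_#|{: qubit * Y}|) (a : R) :=
  exists s : seq (R * 'cV[R[i]]_#|{: qubit * Y}|),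
  [/\ forall q, q \in s -> 0 <= q.1, forall q, q \in s -> is_unit_vector q.2,
     \sum_(q <- s) (q.1)%:C *: ketbra q.2 = S &
     \sum_(q <- s) q.1 * Gconc_pure w q.2 <= a].

Lemma average_ge0 (Y : finType) (S : 'M[R[i]]_#|{: qubit * Y}|) b :
  Gconc_averages w S b -> 0 <= b.
Proof.
move=> [k [p [phi [[p0 _] _ _ ->]]]]; apply: sumr_ge0 => i _.
by rewrite mulr_ge0 // powR_ge0.
Qed.

Lemma tr_ketbra n (phi : 'cV[R[i]]_n) : \tr (ketbra phi) = sqn phi.
Proof. by rewrite /ketbra mxtrace_mulC /mxtrace big_ord1. Qed.

Lemma mixture_average (Y : finType) (S : 'M[R[i]]_#|{: qubit * Y}|) a :
  mixture_le S a -> \tr S = 1 -> exists2 b, Gconc_averages w S b & b <= a.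
Proof.
move=> [s [s0 s1 <- sa]] tr1; exists (\sum_(q <- s) q.1 * Gconc_pure w q.2) => //.
pose q i := nth (0, 0) s i.
have qs (i : 'I_(size s)) : q i \in s by rewrite mem_nth.
exists (size s), (fun i => (q i).1), (fun i => (q i).2); split.
- split=> [i|]; first exact/s0/qs.
  apply: (@complexI R); rewrite rmorph_sum /= -[RHS]tr1 raddf_sum /=.
  rewrite (big_nth (0, 0)) big_mkord; apply: eq_bigr => i _.
  rewrite mxtraceZ tr_ketbra -[LHS]mulr1; congr (_ * _).
  by rewrite -(s1 _ (qs i)).
- by move=> i; apply/s1/qs.
- by rewrite (big_nth (0, 0)) big_mkord.
- by rewrite (big_nth (0, 0)) big_mkord.
Qed.

Lemma Gconc_le (Y : finType) (S : 'M[R[i]]_#|{: qubit * Y}|) a :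
  mixture_le S a -> \tr S = 1 -> 0 <= Gconc w S <= a.
Proof.
move=> Sa tr1; have [b Sb ba] := mixture_average Sa tr1.
apply/andP; split.
  by apply: lb_le_inf; [exists b | move=> c; apply: average_ge0].
apply: le_trans ba; apply: ge_inf => //.
by exists 0 => c; apply: average_ge0.
Qed.

(** Convexity: the decompositions of the [S i] are concatenated, with weights multiplied by
    [p i]. *)
Lemma mixture_sum (Y : finType) (I : Type) (r : seq I) (p a : I -> R)
    (S : I -> 'M[R[i]]_#|{: qubit * Y}|) :
  (forall i, 0 <= p i) -> (forall i, mixture_le (S i) (a i)) ->
  mixture_le (\sum_(i <- r) (p i)%:C *: S i) (\sum_(i <- r) p i * a i).
Proof.
move=> p0 Sa; elim: r => [|i r [s [s0 s1 sE sa]]].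
  by exists [::]; rewrite !big_nil; split.
have [t [t0 t1 tE ta]] := Sa i.
exists ([seq (p i * q.1, q.2) | q <- t] ++ s); split.
- move=> q; rewrite mem_cat => /orP[/mapP[u ut ->]|/s0 //].
  by rewrite mulr_ge0 // t0.
- by move=> q; rewrite mem_cat => /orP[/mapP[u ut ->]|/s1 //]; exact: (t1 _ ut).
- rewrite big_cat big_cons sE big_map -tE scaler_sumr /=; congr (_ + _).
  by apply: eq_bigr => q _; rewrite scalerA -rmorphM.
- rewrite big_cat big_cons big_map /=; apply: lerD => //.
  rewrite (eq_bigr (fun q => p i * (q.1 * Gconc_pure w q.2))).
    by rewrite -mulr_sumr ler_wpM2l.
  by move=> q _; rewrite mulrA.
Qed.

Definition normalized m (x : 'cV[R[i]]_m) := (sqrtC (sqn x))^-1 *: x.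

Lemma ketbra_normalized m (x : 'cV[R[i]]_m) : x != 0 ->
  sqn x *: ketbra (normalized x) = x *m x^t*.
Proof.
move=> x0; have n0 : sqn x != 0 by rewrite normCv_eq0.
rewrite /ketbra /normalized ketbraZ conj_Creal; last first.
  by rewrite ger0_real // invr_ge0 sqrtC_ge0 normCv_ge0.
by rewrite scalerA -invfM -expr2 sqrtCK mulfV // scale1r.
Qed.

Lemma normalized_unit m (x : 'cV[R[i]]_m) : x != 0 ->
  is_unit_vector (normalized x).
Proof.
move=> x0; have n0 : sqn x != 0 by rewrite normCv_eq0.
apply: (mulfI n0); rewrite mulr1.
rewrite -[X in _ * X]/(sqn (normalized x)) -(tr_ketbra (normalized x)).
by rewrite -mxtraceZ ketbra_normalized // -tr_ketbra.
Qed.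

(** The weights are the squared norms, of sum 1 by the trace, so the average of values at most [B]
    is at most [B]. Zero vectors have no normalization and are dropped. *)
Lemma ketsum_mixture (Y : finType) (s : seq 'cV[R[i]]_#|{: qubit * Y}|) B :
  \tr (ketsum s) = 1 ->
  (forall x, x \in s -> x != 0 -> Gconc_pure w (normalized x) <= B) ->
  mixture_le (ketsum s) B.
Proof.
move=> tr1 sB.
have x0E x : x = 0 -> x *m x^t* = 0 :> 'M[R[i]]_#|{: qubit * Y}|.
  by move=> ->; rewrite mul0mx.
exists [seq (complex.Re (sqn x), normalized x) | x <- s & x != 0]; split.
- move=> q /mapP[x _ ->] /=.
  have := normCv_ge0 x; rewrite -/(sqn x) => h.
  by move: (h); rewrite (ge0_ReE h) lecR.
- move=> q /mapP[x]; rewrite mem_filter => /andP[x0 _] ->.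
  exact: normalized_unit.
- rewrite big_map big_filter /ketsum [RHS](bigID (fun x => x != 0)) /=.
  rewrite [X in _ = _ + X]big1 ?addr0; last first.
    by move=> x; rewrite negbK => /eqP; apply: x0E.
  apply: eq_bigr => x x0.
  by rewrite -(ge0_ReE (normCv_ge0 x)) ketbra_normalized.
- rewrite big_map big_filter /=.
  have sum1 : \sum_(x <- s | x != 0) complex.Re (sqn x) = 1.
    apply: (@complexI R); rewrite rmorph_sum /= -[RHS]tr1 tr_ketsum.
    rewrite [RHS](bigID (fun x => x != 0)) /= [X in _ = _ + X]big1 ?addr0.
      by apply: eq_bigr => x _; rewrite -(ge0_ReE (normCv_ge0 x)).
    by move=> x; rewrite negbK => /eqP->; apply/eqP; rewrite normCv_eq0.
  rewrite -[leRHS]mul1r -sum1 mulr_suml big_seq_cond [leRHS]big_seq_cond.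
  apply: ler_sum => x /andP[xs x0]; apply: ler_wpM2l; last exact: sB.
  have h := normCv_ge0 x.
  by move: (h); rewrite (ge0_ReE h) lecR.
Qed.

End Mixtures.

(** * The G-concurrence of two qubits bounded through the concurrence *)

Section TwoQubitUpperBound.
Variables (R : realType) (w : R).
Hypothesis w01 : 0 < w <= 1.
Hypothesis w4 : 2 <= (2 * w ^+ 2) ^+ 2.

(** If M is the amplitude matrix, rho_A = M M^* has determinant |det M|^2. *)
Lemma gram_det_two_qubits (x : 'cV[R[i]]_#|{: qubit * qubit}|) :
  4 * gram_det x = `|bil (spin_flip (R[i])) x x| ^+ 2.
Proof.
have sum2 (F : qubit -> R[i]) : \sum_b F b = F 0 + F 1 by apply: sum_qubit.
rewrite bil_spin_flip normCK /gram_det /det2 !sum2 /amps /amp2.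
by rewrite !(rmorphM, rmorphB) /= rmorph_nat; ring.
Qed.

Lemma bil_normalized m Om (x : 'cV[R[i]]_m) : Om^T = Om ->
  bil Om (normalized x) (normalized x) = (sqn x)^-1 * bil Om x x.
Proof.
by move=> symOm; rewrite bilZl (bilZr symOm) mulrA -invfM -expr2 sqrtCK.
Qed.

(** [equal_concurrence] makes every normalized member have concurrence at most [c]; monotonicity of
    [Gsq] then bounds each of them. *)
Lemma roof_le_mixture (S : 'M[R[i]]_#|{: qubit * qubit}|) c : 0 <= c -> c <= 1 ->
  \tr S = 1 -> roof_le (spin_flip (R[i])) S c%:C ->
  mixture_le w S (Gsq w (c ^+ 2)).
Proof.
move=> c0 c1 tr1 [s0 [S0 hs0]]; rewrite -S0 in tr1 *.
have [s [sE sT]] := equal_concurrence (tr_spin_flip _) tr1 hs0.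
rewrite -sE; apply: ketsum_mixture; first by rewrite sE.
move=> x xs x0; have [t [t01 tE ->]] := Gconc_pureE w (normalized_unit x0).
have n0 : 0 < sqn x by rewrite lt0r normCv_eq0 x0 normCv_ge0.
have tc : t <= c ^+ 2.
  rewrite -lecR -tE gram_det_two_qubits rmorphXn /=.
  have c0' : 0 <= c%:C by rewrite lecR.
  rewrite ler_pXn2r ?nnegrE ?normr_ge0 //.
  rewrite bil_normalized ?tr_spin_flip // normrM normfV (gtr0_norm n0).
  by rewrite mulrC ler_pdivrMr // sT.
have /andP[t0 t1] := t01.
by apply: (le_Gsq w01 w4) => //; rewrite expr_le1.
Qed.

End TwoQubitUpperBound.

(** * Reduced matrices and the final inequality *)

Section Reduction.
Variables (R : realType) (n : nat).

Lemma reduced_AB_ketbra j (phi : 'cV[R[i]]_#|{: qubit * qubits n}|) :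
  reduced_AB j (ketbra phi) = reduced j (amps phi).
Proof.
apply/matrixP => r c; rewrite !mxE.
case: (enum_val r) => a b; case: (enum_val c) => a' b'.
by apply: eq_bigr => y _; rewrite mxE big_ord1 !mxE.
Qed.

Lemma reduced_AB_sum j (I : Type) (r : seq I) (p : I -> R[i])
    (A : I -> 'M[R[i]]_#|{: qubit * qubits n}|) :
  reduced_AB j (\sum_(i <- r) p i *: A i) =
  \sum_(i <- r) p i *: reduced_AB j (A i).
Proof.
apply/matrixP => u v; rewrite summxE mxE.
under [RHS]eq_bigr do rewrite !mxE.
case: (enum_val u) => a b; case: (enum_val v) => a' b'.
rewrite /=; under eq_bigr do rewrite summxE.
rewrite exchange_big /=; apply: eq_bigr => i _.
by rewrite mulr_sumr; apply: eq_bigr => y _; rewrite mxE.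
Qed.

Lemma tr_reduced j (phi : 'cV[R[i]]_#|{: qubit * qubits n}|) :
  \tr (reduced j (amps phi)) = sqn phi.
Proof.
rewrite /mxtrace sum_prod_rank /sqn mxE sum_prod_rank.
apply: eq_bigr => a _.
rewrite (@sum_split_bit _ j _ predT _ 0) //= exchange_big /=.
apply: eq_bigr => b _; rewrite reducedE; apply: eq_bigr => z _.
by rewrite !mxE mulrC.
Qed.

End Reduction.

(* (85 * 10^3 + 798) / 10^5 = 0.85798 *)
Theorem theorem3 (R : realType) (w : R)
    (hw : (85 * 10 ^+ 3 + 798) / 10 ^+ 5 <= w <= 1)
    (N : nat) (hN : (2 <= N)%N)
    (rho : 'M[R[i]]_#|{: qubit * qubits N.-1}|) (hrho : is_density rho) :
  \sum_(j < N.-1) Gconc w (reduced_AB j rho) ^+ 2 <= Gconc w rho ^+ 2.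
Proof.
have [w01 w4] := threshold_bound hw.
have [rhoh rho0 rho1] := hrho.
(* A lower bound of the averages passes to their infimum only if there is one; the columns of a
   factor of [rho] supply it. *)
have nonempty : exists b, Gconc_averages w rho b.
  have [F rhoE] := psd_factor rhoh rho0.
  pose s := [seq col i F | i <- enum 'I_#|{: qubit * qubits N.-1}|].
  have sE : ketsum s = rho.
    by rewrite /ketsum big_map big_enum /= rhoE mulmx_ketsum.
  have [||b hb _] := @mixture_average _ w _ rho (Gsq w 1) => //; last by exists b.
  rewrite -sE; apply: ketsum_mixture; first by rewrite sE.
  move=> x _ x0; have [t [/andP[t0 t1] _ ->]] := Gconc_pureE w (normalized_unit x0).
  exact: (le_Gsq w01 w4).
pose L := \sum_(j < N.-1) Gconc w (reduced_AB j rho) ^+ 2.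
have L0 : 0 <= L by apply: sumr_ge0 => j _; apply: sqr_ge0.
(* Averages are nonnegative, so the square root of [L] bounds each of them from below, hence also
   their infimum. *)
suff lb b : Gconc_averages w rho b -> L <= b ^+ 2.
  have : Num.sqrt L <= Gconc w rho.
    apply: lb_le_inf => // b hb; rewrite -(@ler_pXn2r _ 2) ?nnegrE ?sqrtr_ge0 //.
      by rewrite sqr_sqrtr // lb.
    exact: (average_ge0 hb).
  rewrite -(@ler_pXn2r _ 2) ?nnegrE ?sqrtr_ge0 //; last first.
    by apply: lb_le_inf => // c hc; exact: (average_ge0 hc).
  by rewrite sqr_sqrtr.
move=> [k [p [phi [[p0 p1] phi1 rhoE ->]]]].
have /choice[x hx] : forall i, exists x : R, [/\ 0 <= x <= 1,
    4 * gram_det (phi i) = x%:C & Gconc_pure w (phi i) = Gsq w x].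
  by move=> i; apply: Gconc_pureE.
(* Monogamy of the concurrence for each member of the decomposition, with the complex bounds
   replaced by their real parts. *)
have /choice[c hc] : forall i, exists c : 'I_N.-1 -> R, [/\ forall j, 0 <= c j <= 1,
    forall j, roof_le (spin_flip (R[i])) (reduced j (amps (phi i))) (c j)%:C &
    \sum_j c j ^+ 2 <= x i].
  move=> i; have [x01 xE _] := hx i; have /andP[_ xi1] := x01.
  have [c [c0 cr cs]] :=
    concurrence_monogamy (amps (phi i)) (enum_uniq 'I_N.-1).
  pose d j := complex.Re (c j).
  have cE j : c j = (d j)%:C by apply: ge0_ReE.
  have d0 j : 0 <= d j by rewrite -lecR -cE.
  have ds : \sum_j d j ^+ 2 <= x i.
    rewrite -lecR -xE; apply: le_trans cs; rewrite big_enum /= rmorph_sum.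
    by apply: ler_sum => j _; rewrite cE rmorphXn.
  exists d; split=> // j; last by rewrite -cE; apply: cr; rewrite mem_enum.
  rewrite d0 -(@expr_le1 _ 2) //=; apply: le_trans (le_trans ds xi1).
  by rewrite (bigD1 j) //= lerDl sumr_ge0 // => l _; apply: sqr_ge0.
have Gj j : 0 <= Gconc w (reduced_AB j rho) <=
    \sum_i p i * Gsq w (c i j ^+ 2).
  have SE : reduced_AB j rho =
      \sum_i (p i)%:C *: reduced j (amps (phi i)).
    rewrite rhoE reduced_AB_sum; apply: eq_bigr => i _.
    by rewrite reduced_AB_ketbra.
  apply: Gconc_le; rewrite SE.
    apply: mixture_sum => // i; have [c01 cr _] := hc i.
    have /andP[c0 c1] := c01 j.
    by apply: (roof_le_mixture w01 w4) => //; rewrite tr_reduced; apply: phi1.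
  rewrite raddf_sum /= -[RHS](rmorph1 (real_complex R)) -p1 rmorph_sum /=.
  apply: eq_bigr => i _; rewrite mxtraceZ tr_reduced -[RHS]mulr1.
  by congr (_ * _); apply: phi1.
(* For each i the terms [p i * Gsq w (c i j ^+ 2)] form a vector indexed by j. Superadditivity
   bounds its length by p_i times the G-concurrence of the i-th member, and Minkowski's inequality
   adds up the lengths. *)
apply: (@le_trans _ _ (\sum_(j < N.-1) (\sum_i p i * Gsq w (c i j ^+ 2)) ^+ 2)).
  apply: ler_sum => j _; have /andP[g0 g1] := Gj j.
  by rewrite ler_pXn2r ?nnegrE // (le_trans g0).
apply: Minkowski_sum => [i j|i|i].
- by rewrite mulr_ge0 // Gsq_ge0.
- by rewrite mulr_ge0 // powR_ge0.
have [/andP[x0 x1] _ ->] := hx i; have [c01 _ cs] := hc i.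
rewrite exprMn (eq_bigr (fun j => p i ^+ 2 * Gsq w (c i j ^+ 2) ^+ 2)); last first.
  by move=> j _; rewrite exprMn.
rewrite -mulr_sumr ler_wpM2l ?sqr_ge0 //.
by apply: (Gsq_superadditive w01 w4) => // j; apply: sqr_ge0.
Qed.
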